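(* Let $M$ be a countable structure in a countable signature which is $Th(M)$-recursively saturated and such that (i) $M$ has uniform elimination of imaginaries, (ii) $M$ has an $\emptyset$-definable pairing function, and (iii) $\mathrm{dcl}(\emptyset)$ has at least two elements. Then there is a $Th(M)$-computably uniformly definable function $\partial:D(M)\rightarrow M$ such that $(M, D(M), D(M^{2}), \ldots, \partial)$ is a model of ${\tt \Delta^{1}_{1}\text{-}BL}_{0}$.
   Context: $Th(M)$ is viewed as an element of $2^\omega$ via a Gödel numbering. For $B\in2^\omega$, $M$ is $B$-recursively saturated if every $B$-computable set of formulas in finitely many variables with parameters from a finite subset of $M$, finitely realized in $M$, is realized in $M$. $M$ has uniform elimination of imaginaries if for every $\emptyset$-definable equivalence relation $E$ on $M^n$ there are $m>0$ and an $\emptyset$-definable $f:M^n\to M^m$ with $\bar zE\bar y\iff f(\bar z)=f(\bar y)$. An $\emptyset$-definable pairing function is an $\emptyset$-definable injection $M^2\to M$. $\mathrm{dcl}(\emptyset)$ is the set of elements of $M$ that are $\emptyset$-definable singletons. $D(M^n)$ is the set of subsets of $M^n$ definable with parameters; $(M,D(M),D(M^2),\ldots,\partial)$ is the many-sorted structure with objects $M$, $n$-ary relations $D(M^n)$, $\partial:D(M)\to M$. $\partial$ is $B$-computably uniformly definable if for every formula $\theta(x,\bar y)$ with nonempty parameter tuple $\bar y$ there is $\theta'(x,\bar y)$ with $\partial(\theta(\cdot,\bar a))=b\iff M\models\theta'(b,\bar a)$ for all $\bar a,b$, and $\theta\mapsto\theta'$ is $B$-computable. ${\tt \Delta^1_1\text{-}BL}_0$: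 Basic Law V ($\partial X=\partial Y\leftrightarrow X=Y$) plus, for $\Sigma^1_1$ $\varphi$ and $\Pi^1_1$ $\psi$ (arithmetical formulas, i.e. with no bound relation variables, preceded by a block of existential resp. universal relation quantifiers; parameters allowed), $[\forall\bar n(\varphi(\bar n)\leftrightarrow\psi(\bar n))]\to\exists R\forall\bar n[\bar n\in R\leftrightarrow\varphi(\bar n)]$. *)

(* Defs.v *)
From mathcomp Require Import all_boot.
From mathcomp Require Import boolp classical_sets functions cardinality.

Set Implicit Arguments.
Unset Strict Implicit.
Unset Printing Implicit Defensive.

Local Open Scope classical_set_scope.

(** * Computability relative to an oracle in 2^omega *)

Inductive oprog : Type :=
| OZero
| OSucc
| OProj (i : nat)
| OOracle
| OComp (f : oprog) (gs : seq oprog)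
| ORec (f g : oprog)
| OMu (f : oprog).

(* Graph of the partial function computed by a program with oracle [B]: the
   partial recursive functions in [B].  Argument lists carry the arity. *)
Inductive oeval (B : nat -> bool) : oprog -> seq nat -> nat -> Prop :=
| oeval_zero s : oeval B OZero s 0
| oeval_succ x s : oeval B OSucc (x :: s) x.+1
| oeval_proj i s : i < size s -> oeval B (OProj i) s (nth 0 s i)
| oeval_oracle x s : oeval B OOracle (x :: s) (B x)
| oeval_comp f gs s t y :
    size t = size gs ->
    (forall i, i < size gs -> oeval B (nth OZero gs i) s (nth 0 t i)) ->
    oeval B f t y -> oeval B (OComp f gs) s y
| oeval_rec0 f g s y : oeval B f s y -> oeval B (ORec f g) (0 :: s) y
| oeval_recS f g n s y z :
    oeval B (ORec f g) (n :: s) y -> oeval B g [:: n, y & s] z ->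
    oeval B (ORec f g) (n.+1 :: s) z
| oeval_mu f s n (h : nat -> nat) :
    (forall m, m < n -> oeval B f (m :: s) (h m).+1) ->
    oeval B f (n :: s) 0 -> oeval B (OMu f) s n.

Definition computable_set (B A : nat -> bool) : Prop :=
  exists p, forall n, oeval B p [:: n] (A n).

(** * First-order logic *)

(* The [countType] structures fix an arbitrary injective numbering of the
   symbols; no effectivity of the arities is assumed. *)
Record signature := Signature {
  fsym : countType;
  farity : fsym -> nat;
  rsym : countType;
  rarity : rsym -> nat
}.

Inductive term (L : signature) : Type :=
| Var (i : nat)
| Fun (f : fsym L) (ts : 'I_(farity f) -> term L).
Arguments Var {L} i.
Arguments Fun {L} f ts.

Inductive formula (L : signature) : Type :=
| Eq (t u : term L)
| Rel (r : rsym L) (ts : 'I_(rarity r) -> term L)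
| Bot
| Imp (p q : formula L)
| All (x : nat) (p : formula L).
Arguments Eq {L} t u.
Arguments Rel {L} r ts.
Arguments Bot {L}.
Arguments Imp {L} p q.
Arguments All {L} x p.

Fixpoint tvars L (t : term L) : seq nat :=
  match t with
  | Var i => [:: i]
  | Fun f ts => flatten [seq tvars (ts i) | i <- enum 'I_(farity f)]
  end.

Fixpoint fvars L (p : formula L) : seq nat :=
  match p with
  | Eq t u => tvars t ++ tvars u
  | Rel r ts => flatten [seq tvars (ts i) | i <- enum 'I_(rarity r)]
  | Bot => [::]
  | Imp p q => fvars p ++ fvars q
  | All x p => [seq y <- fvars p | y != x]
  end.

(* [p] is a formula in the free variables 0, ..., n-1 *)
Definition fv_lt L (n : nat) (p : formula L) : bool :=
  all (fun i => i < n) (fvars p).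

(* Goedel numbers; [CodeSeq.code] is a bijection from [seq nat] to [nat]. *)
Fixpoint gn_term L (t : term L) : nat :=
  match t with
  | Var i => CodeSeq.code [:: 0; i]
  | Fun f ts =>
      CodeSeq.code [:: 1, pickle f & [seq gn_term (ts i) | i <- enum 'I_(farity f)]]
  end.

Fixpoint gn L (p : formula L) : nat :=
  match p with
  | Eq t u => CodeSeq.code [:: 0; gn_term t; gn_term u]
  | Rel r ts =>
      CodeSeq.code [:: 1, pickle r & [seq gn_term (ts i) | i <- enum 'I_(rarity r)]]
  | Bot => CodeSeq.code [:: 2]
  | Imp p q => CodeSeq.code [:: 3; gn p; gn q]
  | All x p => CodeSeq.code [:: 4; x; gn p]
  end.

Record structure (L : signature) := Structure {
  carrier :> Type;
  finterp : forall f : fsym L, (farity f).-tuple carrier -> carrier;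
  rinterp : forall r : rsym L, (rarity r).-tuple carrier -> Prop
}.

Fixpoint teval L (M : structure L) (v : nat -> M) (t : term L) : M :=
  match t with
  | Var i => v i
  | Fun f ts => finterp [tuple teval v (ts i) | i < farity f]
  end.

Fixpoint sat L (M : structure L) (v : nat -> M) (p : formula L) : Prop :=
  match p with
  | Eq t u => teval v t = teval v u
  | Rel r ts => rinterp [tuple teval v (ts i) | i < rarity r]
  | Bot => False
  | Imp p q => sat v p -> sat v q
  | All x p => forall a : M, sat [eta v with x |-> a] p
  end.

(* the assignment [v] with variables 0, ..., size s - 1 sent to the entries of [s] *)
Definition extend (T : Type) (s : seq T) (v : nat -> T) : nat -> T :=
  fun i => nth (v i) s i.

(* M |= p(s); when [fv_lt (size s) p] the choice of [v] is immaterial. *)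
Definition holds L (M : structure L) (p : formula L) (s : seq M) : Prop :=
  forall v : nat -> M, sat (extend s v) p.

(* Th(M) as an element of 2^omega *)
Definition Th L (M : structure L) : nat -> bool := fun n =>
  `[< exists p : formula L, [/\ fv_lt 0 p, holds (M := M) p [::] & gn p = n] >].

(** * Definability *)

Definition definable0 L (M : structure L) n (S : set (n.-tuple M)) : Prop :=
  exists2 p : formula L, fv_lt n p & forall x : n.-tuple M, S x <-> holds p x.

Definition definable L (M : structure L) n (S : set (n.-tuple M)) : Prop :=
  exists k (a : k.-tuple M) (p : formula L),
    fv_lt (n + k) p /\ forall x : n.-tuple M, S x <-> holds p (x ++ a).

Definition definable0_fun L (M : structure L) n m
    (f : n.-tuple M -> m.-tuple M) : Prop :=
  definable0 (range (fun z : n.-tuple M => [tuple of z ++ f z])).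

Definition definable0_rel L (M : structure L) n
    (E : n.-tuple M -> n.-tuple M -> Prop) : Prop :=
  definable0 [set [tuple of (zy.1 : n.-tuple M) ++ (zy.2 : n.-tuple M)] |
    zy in [set zy : n.-tuple M * n.-tuple M | E zy.1 zy.2]].

Definition dcl0 L (M : structure L) : set M :=
  [set a | definable0 [set [tuple a]]].

Definition uniform_EI L (M : structure L) : Prop :=
  forall n (E : n.-tuple M -> n.-tuple M -> Prop),
    RelationClasses.Equivalence E -> definable0_rel E ->
    exists m (f : n.-tuple M -> m.-tuple M),
      [/\ 0 < m, definable0_fun f & forall z y, E z y <-> f z = f y].

Definition has_pairing0 L (M : structure L) : Prop :=
  exists f : M * M -> M,
    injective f /\ definable0 (range (fun ab : M * M => [tuple ab.1; ab.2; f ab])).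

(** * Recursive saturation *)

(* Variables 0, ..., n-1 are those of the type; variables n, ..., n+k-1 stand
   for the parameters [a]. *)
Definition realizes L (M : structure L) (G : set (formula L)) n k
    (x : n.-tuple M) (a : k.-tuple M) : Prop :=
  forall p, G p -> holds p (x ++ a).

Definition recursively_saturated (B : nat -> bool) L (M : structure L) : Prop :=
  forall n k (a : k.-tuple M) (G : set (formula L)),
    (forall p, G p -> fv_lt (n + k) p) ->
    computable_set B (fun c => `[< exists2 p, G p & gn p = c >]) ->
    (forall G0 : set (formula L), finite_set G0 -> G0 `<=` G ->
      exists x : n.-tuple M, realizes G0 x a) ->
    exists x : n.-tuple M, realizes G x a.

(** * The structure (M, D(M), D(M^2), ..., ext) *)

Definition D L (M : structure L) (n : nat) : Type :=
  {S : set (n.-tuple M) | definable S}.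

Lemma definable_fiber L (M : structure L) n k (th : formula L)
    (a : k.-tuple M) :
  fv_lt (n + k) th -> definable [set x : n.-tuple M | holds th (x ++ a)].
Proof. by move=> th_nk; exists k, a, th. Qed.

(* theta(., a) as an element of D(M) *)
Definition fiber L (M : structure L) k (th : formula L) (a : k.-tuple M)
    (th_k : fv_lt (1 + k) th) : D M 1 :=
  exist _ [set x : 1.-tuple M | holds th (x ++ a)] (definable_fiber a th_k).

(* Formulas theta(x, y_1, ..., y_k), k > 0, have x = variable 0 and
   y_i = variable i; the map theta |-> theta' is given k together with theta. *)
Definition computably_uniformly_definable (B : nat -> bool) L
    (M : structure L) (ext : D M 1 -> M) : Prop :=
  exists T : nat -> formula L -> formula L,
    (forall k (th : formula L) (th_k : fv_lt (1 + k) th), 0 < k ->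
       fv_lt (1 + k) (T k th) /\
       forall (a : k.-tuple M) (b : M),
         ext (fiber a th_k) = b <-> holds (T k th) (b :: a)) /\
    (exists p : oprog, forall k (th : formula L), 0 < k -> fv_lt (1 + k) th ->
       oeval B p [:: k; gn th] (gn (T k th))).

(** * The language of Basic Law V *)

(* Sort [relsort n] interprets relation variables of arity n+1. *)
Record blstruct := BLStruct {
  obj : Type;
  relsort : nat -> Type;
  bapp : forall n, relsort n -> n.+1.-tuple obj -> Prop;
  bext : relsort 0 -> obj
}.

Inductive blterm : Type :=
| BVar (x : nat)
| BExt (X : nat).

Inductive blformula : Type :=
| BEq (t u : blterm)
| BREq (n X Y : nat)
| BApp (n X : nat) (ts : n.+1.-tuple blterm)
| BBot
| BImp (p q : blformula)
| BAll (x : nat) (p : blformula)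
| BRAll (n X : nat) (p : blformula)
| BREx (n X : nat) (p : blformula).

Definition set_rel (A : blstruct) (r : forall n, nat -> relsort A n) n (X : nat)
    (R : relsort A n) : forall n, nat -> relsort A n :=
  dfwith r [eta r n with X |-> R].

Definition bleval (A : blstruct) (v : nat -> obj A) (r : forall n, nat -> relsort A n)
    (t : blterm) : obj A :=
  match t with
  | BVar x => v x
  | BExt X => bext (r 0 X)
  end.

Fixpoint blsat (A : blstruct) (v : nat -> obj A) (r : forall n, nat -> relsort A n)
    (p : blformula) : Prop :=
  match p with
  | BEq t u => bleval v r t = bleval v r u
  | BREq n X Y => r n X = r n Y
  | BApp n X ts => bapp (r n X) (map_tuple (bleval v r) ts)
  | BBot => False
  | BImp p q => blsat v r p -> blsat v r q
  | BAll x p => forall a : obj A, blsat [eta v with x |-> a] r p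
  | BRAll n X p => forall R : relsort A n, blsat v (set_rel r X R) p
  | BREx n X p => exists R : relsort A n, blsat v (set_rel r X R) p
  end.

Fixpoint arithmetical (p : blformula) : bool :=
  match p with
  | BEq _ _ | BREq _ _ _ | BApp _ _ _ | BBot => true
  | BImp p q => arithmetical p && arithmetical q
  | BAll _ p => arithmetical p
  | BRAll _ _ _ | BREx _ _ _ => false
  end.

Fixpoint sigma11 (p : blformula) : bool :=
  if p is BREx _ _ q then sigma11 q else arithmetical p.

Fixpoint pi11 (p : blformula) : bool :=
  if p is BRAll _ _ q then pi11 q else arithmetical p.

Definition basic_law_V (A : blstruct) : Prop :=
  forall X Y : relsort A 0, bext X = bext Y <-> X = Y.

(* The tuple being comprehended is that of the variables 0, ..., n; all other
   object variables and all relation variables are parameters. *)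
Definition delta11_comprehension (A : blstruct) : Prop :=
  forall (n : nat) (phi psi : blformula) (v : nat -> obj A)
         (r : forall n, nat -> relsort A n),
    sigma11 phi -> pi11 psi ->
    (forall a : n.+1.-tuple (obj A),
       blsat (extend a v) r phi <-> blsat (extend a v) r psi) ->
    exists R : relsort A n, forall a : n.+1.-tuple (obj A),
      bapp R a <-> blsat (extend a v) r phi.

Definition Delta11_BL0 (A : blstruct) : Prop :=
  basic_law_V A /\ delta11_comprehension A.

Definition definable_blstruct L (M : structure L) (ext : D M 1 -> M) : blstruct :=
  BLStruct (relsort := fun n => D M n.+1) (fun n (R : D M n.+1) a => sval R a) ext.

(* Main.v *)
Require Import Defs.
From mathcomp Require Import all_boot.
From mathcomp Require Import boolp classical_sets functions cardinality.
From mathcomp Require Import zify.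

Set Implicit Arguments.
Unset Strict Implicit.
Unset Printing Implicit Defensive.

Local Open Scope classical_set_scope.

(** By pairing, every definable set is defined with a single parameter. Let
    [th_c] be the formula with number [c], and let [ker c] be the function
    given by elimination of imaginaries for the relation
    "[th_c(., u)] and [th_c(., u')] define the same set"; a formula for it is
    found by searching through [Th M]. The extension of a definable set [X] is
    [ker c u] tagged by [c], where [c] is least such that [X = th_c(., u)] for
    some [u]; the two distinct elements of [dcl0 M] and the pairing function
    supply the tags. "Least" costs only a finite disjunction once a number of
    [X] is known, which gives uniform definability.

    For comprehension, once numbers are fixed for the relation variables,
    arithmetical formulas translate computably into the language of [M].
    A Sigma^1_1 formula [phi] thus is an infinite disjunction of formulas of
    [M], and a Pi^1_1 formula [psi] an infinite conjunction. If they are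
    equivalent, the set of the negated disjuncts of [phi] together with the
    conjuncts of [psi] is not realized; by saturation finitely many of its
    members are already inconsistent, and [phi] is equivalent to a finite
    disjunction. *)

(** * Closure properties of the functions computable from an oracle *)

Section OracleComputability.
Variable B : nat -> bool.

(** Argument tuples are lists, so that inputs can be rearranged by [nth] and [drop]; nothing is
    required on lists whose length is not [n]. *)
Definition cmp n (f : seq nat -> nat) : Prop :=
  exists p, forall s, size s = n -> oeval B p s (f s).

Lemma eq_cmp n f g : (forall s, size s = n -> f s = g s) -> cmp n f -> cmp n g.
Proof. by move=> fg [p fp]; exists p => s sn; rewrite -fg//; exact: fp. Qed.

Lemma cmp_comp n k (f : seq nat -> nat) (gs : seq (seq nat -> nat)) :
  size gs = k -> cmp k f ->
  (forall i, i < k -> cmp n (nth (fun=> 0) gs i)) ->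
  cmp n (fun s => f [seq g s | g <- gs]).
Proof.
move=> gsk [p fp] gP.
have [P PE] : exists P : nat -> oprog, forall i, i < k -> forall s, size s = n ->
    oeval B (P i) s (nth (fun=> 0) gs i s).
  have /choice[P PE] : forall i, exists q, i < k -> forall s, size s = n ->
      oeval B q s (nth (fun=> 0) gs i s).
    move=> i; have [ik|_] := boolP (i < k); last by exists OZero.
    by have [q qP] := gP i ik; exists q.
  by exists P.
exists (OComp p (mkseq P k)) => s sn.
apply: (@oeval_comp _ _ _ _ [seq g s | g <- gs]).
- by rewrite size_map size_mkseq.
- move=> i; rewrite size_mkseq => ik.
  by rewrite nth_mkseq// (nth_map (fun=> 0)) ?gsk//; exact: PE.
- by apply: fp; rewrite size_map.
Qed.

Lemma cmp_nth n i : i < n -> cmp n (fun s => nth 0 s i).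
Proof. by move=> lin; exists (OProj i) => s sn; constructor; rewrite sn. Qed.

Lemma cmp_unary n f g :
  cmp 1 (fun s => f (nth 0 s 0)) -> cmp n g -> cmp n (fun s => f (g s)).
Proof.
move=> cf cg; apply: (@cmp_comp n 1 (fun t => f (nth 0 t 0)) [:: g]) => //.
by case.
Qed.

Lemma cmp_binary n f g h :
  cmp 2 (fun s => f (nth 0 s 0) (nth 0 s 1)) -> cmp n g -> cmp n h ->
  cmp n (fun s => f (g s) (h s)).
Proof.
move=> cf cg ch.
apply: (@cmp_comp n 2 (fun t => f (nth 0 t 0) (nth 0 t 1)) [:: g; h]) => //.
by case=> [|[]].
Qed.

Lemma cmp_succ n f : cmp n f -> cmp n (fun s => (f s).+1).
Proof. by apply: cmp_unary; exists OSucc => -[|x []]//= _; constructor. Qed.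

Lemma cmp_const n c : cmp n (fun=> c).
Proof.
elim: c => [|c IH]; last exact: cmp_succ IH.
by exists OZero => s _; constructor.
Qed.

Lemma cmp_oracle n f : cmp n f -> cmp n (fun s => (B (f s) : nat)).
Proof.
by apply: (@cmp_unary _ (fun m => B m : nat)); exists OOracle => -[|x []]//= _;
  constructor.
Qed.

(** Composition with the projections [k, ..., k + n - 1]. It lets the body of a loop, which has its
    counter and accumulator in front, use functions of the outer arguments. *)
Lemma cmp_drop n f k : cmp n f -> cmp (k + n) (fun t => f (drop k t)).
Proof.
move=> cf; pose gs := [seq (fun t : seq nat => nth 0 t i) | i <- iota k n].
have gsn : size gs = n by rewrite size_map size_iota.
have := @cmp_comp (k + n) n f gs gsn cf; move=> H.
apply: eq_cmp (H _) => [t tn|i lin].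
  congr f; apply: (@eq_from_nth _ 0).
    by rewrite size_map gsn size_drop tn addKn.
  move=> i; rewrite size_map gsn => lin.
  rewrite (nth_map (fun=> 0)) ?gsn// (nth_map 0) ?size_iota//.
  by rewrite nth_iota// nth_drop.
rewrite (nth_map 0) ?size_iota// nth_iota//.
by apply: cmp_nth; rewrite ltn_add2l.
Qed.

(** Primitive recursion: [ORec] computes the loop with its length as an extra first argument, which
    is then filled with [m]. *)
Lemma cmp_iteri n (a m : seq nat -> nat) (F : nat -> nat -> seq nat -> nat) :
  cmp n m -> cmp n a ->
  cmp n.+2 (fun t => F (nth 0 t 0) (nth 0 t 1) (drop 2 t)) ->
  cmp n (fun s => iteri (m s) (fun i y => F i y s) (a s)).
Proof.
move=> cm [p pa] [q qF].
pose f (t : seq nat) := iteri (nth 0 t 0) (fun i y => F i y (behead t)) (a (behead t)).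
have cf : cmp n.+1 f.
  exists (ORec p q) => -[//|k s] [sn]; rewrite /f /=.
  elim: k => [|k IH]; first by constructor; exact: pa.
  apply: oeval_recS IH _.
  have := qF [:: k, iteri k (fun i y => F i y s) (a s) & s].
  by rewrite /= drop0 sn; exact.
pose gs := m :: [seq (fun t : seq nat => nth 0 t i) | i <- iota 0 n].
have gsn : size gs = n.+1 by rewrite /= size_map size_iota.
have H := @cmp_comp n n.+1 f gs gsn cf.
apply: eq_cmp (H _) => [s sn|[|i]//= lin].
  rewrite /f /=; have -> : [seq g s | g <- [seq nth 0^~ i | i <- iota 0 n]] = s; last by [].
  rewrite -map_comp -[RHS](mkseq_nth 0) sn; exact: eq_map.
by rewrite (nth_map 0) ?size_iota// nth_iota//; apply: cmp_nth.
Qed.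

Lemma cmp_mu n (f : nat -> seq nat -> nat) g :
  cmp n.+1 (fun t => f (nth 0 t 0) (drop 1 t)) ->
  (forall s, size s = n -> f (g s) s = 0 /\ forall m, m < g s -> f m s != 0) ->
  cmp n g.
Proof.
move=> [p pf] gP; exists (OMu p) => s sn.
have [f0 fn0] := gP s sn.
(* [oeval_mu] records the nonzero values before the first zero as successors, hence the
   predecessor. *)
apply: (@oeval_mu _ _ _ _ (fun m => (f m s).-1)) => [m mg|].
  rewrite prednK ?lt0n ?fn0//.
  by have := pf (m :: s); rewrite /= drop0 sn; apply.
by have := pf (g s :: s); rewrite /= drop0 f0 sn; apply.
Qed.

Lemma cmp_drop2 n f : cmp n f -> cmp n.+2 (fun t => f (drop 2 t)).
Proof. exact: (@cmp_drop n f 2). Qed.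

Lemma cmp_nth_drop n i k : i < n -> cmp (k + n) (fun t => nth 0 (drop k t) i).
Proof. by move=> lin; apply: (@cmp_drop n (fun t => nth 0 t i)); exact: cmp_nth. Qed.

Lemma cmp_add n f g : cmp n f -> cmp n g -> cmp n (fun s => f s + g s).
Proof.
apply: cmp_binary.
apply: (@eq_cmp _ (fun s => iteri (nth 0 s 0) (fun _ y => y.+1) (nth 0 s 1))).
  by move=> s _; elim: (nth 0 s 0) => //= k ->; rewrite addSn.
apply: (@cmp_iteri _ _ _ (fun _ y _ => y.+1)); try exact: cmp_nth.
by apply: cmp_succ; exact: cmp_nth.
Qed.

Lemma cmp_mul n f g : cmp n f -> cmp n g -> cmp n (fun s => f s * g s).
Proof.
apply: cmp_binary.
apply: (@eq_cmp _ (fun s => iteri (nth 0 s 0) (fun _ y => nth 0 s 1 + y) 0)).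
  by move=> s _; elim: (nth 0 s 0) => //= k ->; rewrite mulSn.
apply: (@cmp_iteri _ _ _ (fun _ y s => nth 0 s 1 + y)).
- exact: cmp_nth.
- exact: cmp_const.
- by apply: cmp_add; [exact: (@cmp_nth_drop 2 1 2)|exact: cmp_nth].
Qed.

Lemma cmp_exp n f g : cmp n f -> cmp n g -> cmp n (fun s => f s ^ g s).
Proof.
apply: cmp_binary.
apply: (@eq_cmp _ (fun s => iteri (nth 0 s 1) (fun _ y => nth 0 s 0 * y) 1)).
  by move=> s _; elim: (nth 0 s 1) => //= k ->; rewrite expnS.
apply: (@cmp_iteri _ _ _ (fun _ y s => nth 0 s 0 * y)).
- exact: cmp_nth.
- exact: cmp_const.
- by apply: cmp_mul; [exact: (@cmp_nth_drop 2 0 2)|exact: cmp_nth].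
Qed.

Lemma cmp_pred n f : cmp n f -> cmp n (fun s => (f s).-1).
Proof.
apply: cmp_unary.
apply: (@eq_cmp _ (fun s => iteri (nth 0 s 0) (fun i _ => i) 0)).
  by move=> s _; case: (nth 0 s 0).
apply: (@cmp_iteri _ _ _ (fun i _ _ => i)); by [exact: cmp_nth|exact: cmp_const].
Qed.

Lemma cmp_sub n f g : cmp n f -> cmp n g -> cmp n (fun s => f s - g s).
Proof.
apply: cmp_binary.
apply: (@eq_cmp _ (fun s => iteri (nth 0 s 1) (fun _ y => y.-1) (nth 0 s 0))).
  by move=> s _; elim: (nth 0 s 1) => [|k /= ->]; rewrite ?subn0// subnS.
apply: (@cmp_iteri _ _ _ (fun _ y _ => y.-1)); try exact: cmp_nth.
by apply: cmp_pred; exact: cmp_nth.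
Qed.

Definition cmpb n (f : seq nat -> bool) := cmp n (fun s => f s : nat).

Lemma cmpb_leq n f g : cmp n f -> cmp n g -> cmpb n (fun s => f s <= g s).
Proof.
move=> cf cg; apply: (@eq_cmp _ (fun s => 1 - (f s - g s))).
  by move=> s _; case: leqP => H; lia.
by apply: cmp_sub; [exact: cmp_const|exact: cmp_sub].
Qed.

Lemma cmpb_and n f g : cmpb n f -> cmpb n g -> cmpb n (fun s => f s && g s).
Proof.
move=> cf cg; apply: (@eq_cmp _ (fun s => f s * g s)); last exact: cmp_mul.
by move=> s _; case: (f s); case: (g s).
Qed.

Lemma cmpb_neg n f : cmpb n f -> cmpb n (fun s => ~~ f s).
Proof.
move=> cf; apply: (@eq_cmp _ (fun s => 1 - f s)).
  by move=> s _; case: (f s).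
by apply: cmp_sub; [exact: cmp_const|].
Qed.

Lemma cmpb_eq n f g : cmp n f -> cmp n g -> cmpb n (fun s => f s == g s).
Proof.
move=> cf cg; apply: (@eq_cmp _ (fun s => (f s <= g s) && (g s <= f s) : nat)).
  by move=> s _; rewrite eqn_leq.
by apply: cmpb_and; exact: cmpb_leq.
Qed.

Lemma cmp_if n (b : seq nat -> bool) f g : cmpb n b -> cmp n f -> cmp n g ->
  cmp n (fun s => if b s then f s else g s).
Proof.
move=> cb cf cg; apply: (@eq_cmp _ (fun s => b s * f s + ~~ b s * g s)).
  by move=> s _; case: (b s); rewrite ?mul1n ?mul0n ?addn0.
by apply: cmp_add; apply: cmp_mul => //; exact: cmpb_neg.
Qed.

Lemma cmpb_has_iota n (b : nat -> seq nat -> bool) m : cmp n m ->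
  cmpb n.+2 (fun t => b (nth 0 t 0) (drop 2 t)) ->
  cmpb n (fun s => has (b^~ s) (iota 0 (m s))).
Proof.
move=> cm cb.
apply: (@eq_cmp _ (fun s => iteri (m s) (fun i y => if b i s then 1 else y) 0)).
  move=> s _; elim: (m s) => // k IH; rewrite [LHS]/= IH -[in RHS]addn1 iotaD.
  by rewrite has_cat /= orbF; case: (b k s); rewrite ?orbT ?orbF.
apply: (@cmp_iteri _ _ _ (fun i y s => if b i s then 1 else y)) => //.
- exact: cmp_const.
- by apply: cmp_if => //; [exact: cmp_const|exact: cmp_nth].
Qed.

(** The code of [x :: s] is [2 ^ x] times the odd number [2 * code s + 1]. *)
Lemma cmp_code n (fs : seq (seq nat -> nat)) :
  (forall i, i < size fs -> cmp n (nth (fun=> 0) fs i)) ->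
  cmp n (fun s => CodeSeq.code [seq f s | f <- fs]).
Proof.
elim: fs => [|f fs IH] cfs; first exact: cmp_const.
have c0 := cfs 0 isT; have {IH} c1 := IH (fun i lin => cfs i.+1 lin).
apply: (@eq_cmp _ (fun s =>
  2 ^ f s * (2 * CodeSeq.code [seq f s | f <- fs]).+1)).
  by move=> s _ /=; rewrite mul2n.
apply: cmp_mul; first by apply: cmp_exp c0; exact: cmp_const.
by apply: cmp_succ; apply: cmp_mul c1; exact: cmp_const.
Qed.

Lemma cmp_computable_set A : cmpb 1 (fun s => A (nth 0 s 0)) -> computable_set B A.
Proof. by case=> p pA; exists p => n; exact: (pA [:: n]). Qed.

Fixpoint isqrt n := if n is m.+1 then
  (if (isqrt m).+1 ^ 2 <= m.+1 then (isqrt m).+1 else isqrt m) else 0.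

Lemma isqrtP n : isqrt n ^ 2 <= n < (isqrt n).+1 ^ 2.
Proof.
elim: n => //= n; set r := isqrt n => /andP[rn nr].
case: ifP => h; apply/andP; split=> //.
- by rewrite (leq_ltn_trans nr)// ltn_exp2r.
- exact: leqW.
- by rewrite ltnNge h.
Qed.

Lemma isqrt_uniq r n : r ^ 2 <= n < r.+1 ^ 2 -> isqrt n = r.
Proof.
move=> /andP[rn nr]; have /andP[sn ns] := isqrtP n.
have := leq_ltn_trans sn nr; have := leq_ltn_trans rn ns.
by rewrite !ltn_exp2r// !ltnS => a b; apply/eqP; rewrite eqn_leq a b.
Qed.

(* [(a + b)^2 + a] is the code of the pair [(a, b)]. *)
Definition upr1 n := n - isqrt n ^ 2.
Definition upr2 n := isqrt n - upr1 n.

(** One index can thus range over all pairs and, iterated, over the formula numbers for a whole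
    block of relation quantifiers. *)
Lemma upr_surj a b : exists n, upr1 n = a /\ upr2 n = b.
Proof.
exists ((a + b) ^ 2 + a); have e : isqrt ((a + b) ^ 2 + a) = a + b.
  by apply: isqrt_uniq; nia.
by rewrite /upr2 /upr1 e !addKn.
Qed.

Lemma cmp_isqrt n f : cmp n f -> cmp n (fun s => isqrt (f s)).
Proof.
apply: cmp_unary.
apply: (@eq_cmp _ (fun s => iteri (nth 0 s 0)
  (fun i y => if y.+1 ^ 2 <= i.+1 then y.+1 else y) 0)).
  by move=> s _; elim: (nth 0 s 0) => //= k ->.
apply: (@cmp_iteri _ _ _ (fun i y _ => if y.+1 ^ 2 <= i.+1 then y.+1 else y)).
- exact: cmp_nth.
- exact: cmp_const.
- apply: cmp_if; last exact: cmp_nth; last by apply: cmp_succ; exact: cmp_nth.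
  apply: cmpb_leq; last by apply: cmp_succ; exact: cmp_nth.
  by apply: cmp_exp; [apply: cmp_succ; exact: cmp_nth|exact: cmp_const].
Qed.

Lemma cmp_upr1 n f : cmp n f -> cmp n (fun s => upr1 (f s)).
Proof.
move=> cf; apply: cmp_sub => //.
by apply: cmp_exp; [exact: cmp_isqrt|exact: cmp_const].
Qed.

Lemma cmp_upr2 n f : cmp n f -> cmp n (fun s => upr2 (f s)).
Proof.
by move=> cf; apply: cmp_sub; [exact: cmp_isqrt|exact: cmp_upr1].
Qed.

End OracleComputability.

Local Arguments CodeSeq.code : simpl never.

(** * Goedel numbers and substitution *)

Section Syntax.
Variable L : signature.
Implicit Types (p q : formula L) (t u : term L).

Let code_inj : injective CodeSeq.code := can_inj CodeSeq.codeK.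

Lemma gn_term_inj : injective (@gn_term L).
Proof.
have args_inj n (ts us : 'I_n -> term L) :
    (forall i u, gn_term (ts i) = gn_term u -> ts i = u) ->
    [seq gn_term (ts i) | i <- enum 'I_n] = [seq gn_term (us i) | i <- enum 'I_n] ->
    ts = us.
  move=> IH /eq_in_map tsus; apply/funext => i.
  by apply: IH; apply: tsus; rewrite mem_enum.
elim=> [i|f ts IH] [j|g us] /= /code_inj //; first by case=> ->.
case=> /(pcan_inj pickleK) fg; case: g / fg us => us e.
by congr Defs.Fun; exact: args_inj IH e.
Qed.

Lemma gn_inj : injective (@gn L).
Proof.
elim=> [t u|r ts||p IHp q IHq|x p IHp] [t' u'|r' ts'||p' q'|x' p'] /= /code_inj //.
- by case=> /gn_term_inj -> /gn_term_inj ->.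
- case=> /(pcan_inj pickleK) rr; case: r' / rr ts' => ts' /eq_in_map e.
  by congr Rel; apply/funext => i; apply: gn_term_inj; apply: e; rewrite mem_enum.
- by case=> /IHp -> /IHq ->.
- by case=> -> /IHp ->.
Qed.

(** A sequence code exceeds its entries. A formula that mentions [i] as a bound variable therefore
    bounds [i], so that a computable family of such formulas has a decidable range. *)
Lemma leq_gn_Imp_All i p q : i <= gn (Imp (All i p) q).
Proof.
have /and4P[_ lt1 _ _] := CodeSeq.ltn_code [:: 4; i; gn p].
have /and4P[_ lt2 _ _] := CodeSeq.ltn_code [:: 3; gn (All i p); gn q].
exact: ltnW (ltn_trans lt1 lt2).
Qed.

Definition Not p := Imp p Bot.
Definition And p q := Not (Imp p (Not q)).
Definition Ex x p := Not (All x (Not p)).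
Definition Iff p q := And (Imp p q) (Imp q p).

(* [letv x y p] is [p] with [x] replaced by [y]; quantifying over [x] avoids
   the capture of [y] by quantifiers of [p]. *)
Definition letv x y p := All x (Imp (Eq (Var x) (Var y)) p).

(** The variables [c, ..., c + m - 1] are replaced by [b 0, ..., b (m - 1)]. *)
Fixpoint letblock c m (b : nat -> nat) p :=
  if m is m'.+1 then letblock c m' b (letv (c + m') (b m') p) else p.

(** Exceeds the entries of [ys] and the variables [0, ..., size ys - 1], so the block starting here
    is disjoint from both. It depends on [ys] alone, so no formula has to be decoded to find it. *)
Definition subst_base (ys : seq nat) := (size ys + sumn ys).+1.

(* The variables [ys] are first copied to fresh ones, since they may overlap
   with the variables [0, 1, ...] that they replace. *)
Definition subst p (ys : seq nat) := locked
  (letblock (subst_base ys) (size ys) (nth 0 ys)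
    (letblock 0 (size ys) (addn (subst_base ys)) p)).

(** Generalizes [fv_lt]: passing under a quantifier adds one variable to [Q], which a mere bound
    could not express. *)
Definition fvin (Q : pred nat) p := all Q (fvars p).

Lemma fv_ltE n p : fv_lt n p = fvin (fun i => i < n) p. Proof. by []. Qed.

Lemma sub_fvin (Q Q' : pred nat) p :
  (forall i, Q i -> Q' i) -> fvin Q p -> fvin Q' p.
Proof. by move=> QQ; apply: sub_all. Qed.

Lemma fv_lt_leq m n p : m <= n -> fv_lt m p -> fv_lt n p.
Proof. by move=> mn; apply: sub_fvin => i im; exact: leq_trans im mn. Qed.

Lemma fvin_Imp Q p q : fvin Q (Imp p q) = fvin Q p && fvin Q q.
Proof. exact: all_cat. Qed.

Lemma fvin_All Q x p : fvin Q (All x p) = fvin (fun y => (y != x) ==> Q y) p.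
Proof. by rewrite /fvin /= all_filter. Qed.

Lemma fvin_Not Q p : fvin Q (Not p) = fvin Q p.
Proof. by rewrite fvin_Imp andbT. Qed.

Lemma fvin_And Q p q : fvin Q (And p q) = fvin Q p && fvin Q q.
Proof. by rewrite fvin_Not fvin_Imp fvin_Not. Qed.

Lemma fvin_Iff Q p q : fvin Q (Iff p q) = fvin Q p && fvin Q q.
Proof. by rewrite fvin_And !fvin_Imp [fvin Q q && _]andbC andbb. Qed.

Lemma fvin_Ex Q x p : fvin Q (Ex x p) = fvin (fun y => (y != x) ==> Q y) p.
Proof. by rewrite fvin_Not fvin_All fvin_Not. Qed.

Lemma fvin_Eqv Q x y : fvin Q (Eq (Var x) (Var y)) = Q x && Q y.
Proof. by rewrite /fvin /= andbT. Qed.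

Lemma fvin_letv Q x y p : fvin Q (letv x y p) =
  ((y != x) ==> Q y) && fvin (fun z => (z != x) ==> Q z) p.
Proof. by rewrite fvin_All fvin_Imp fvin_Eqv eqxx. Qed.

Definition fvinE := (fvin_letv, fvin_Ex, fvin_Iff, fvin_And, fvin_Not,
  fvin_All, fvin_Imp, fvin_Eqv).

Lemma fvin_letblock (Q : pred nat) c m b p :
  (forall i, i < m -> Q (b i)) -> fvin (fun z => (c <= z < c + m) || Q z) p ->
  fvin Q (letblock c m b p).
Proof.
elim: m p => [|m IH] p Qb pQ /=.
  by apply: sub_fvin pQ => i; rewrite addn0; case: (Q i) => //; lia.
apply: IH => [i im|]; first exact/Qb/ltnW.
rewrite fvin_letv Qb ?orbT ?implybT//=.
by apply: sub_fvin pQ => i; case: (Q i); rewrite ?orbT ?implybT//; lia.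
Qed.

Lemma fvin_subst (Q : pred nat) p ys :
  fv_lt (size ys) p -> all Q ys -> fvin Q (subst p ys).
Proof.
move=> py /allP Qy; rewrite /subst -lock; apply: fvin_letblock => [i ?|]; first exact/Qy/mem_nth.
apply: fvin_letblock => [i|]; first by rewrite leq_addr ltn_add2l => ->.
by apply: sub_fvin py => i ->.
Qed.

(** * Semantics of the connectives and of substitution *)

Section Sat.
Variable M : structure L.
Implicit Types (v w : nat -> M) (s : seq M).

Lemma teval_eq v w t : {in tvars t, v =1 w} -> teval v t = teval w t.
Proof.
elim: t => [i|f ts IH] /= vw; first by apply: vw; rewrite inE.
congr finterp; apply: eq_mktuple => i; apply: IH => j jt; apply: vw.
by apply/flatten_mapP; exists i; rewrite ?mem_enum.
Qed.

Lemma sat_eq v w p : {in fvars p, v =1 w} -> sat v p <-> sat w p.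
Proof.
elim: p v w => [t u|r ts||p IHp q IHq|x p IHp] v w /= vw //.
- by rewrite !(@teval_eq v w)// => i it; apply: vw; rewrite mem_cat it ?orbT.
- suff -> : [tuple teval v (ts i) | i < rarity r] = [tuple teval w (ts i) | i < rarity r] by [].
  apply: eq_mktuple => i; apply: teval_eq => j jt; apply: vw.
  by apply/flatten_mapP; exists i; rewrite ?mem_enum.
- have /IHp p1 : {in fvars p, v =1 w} by move=> i ip; apply: vw; rewrite mem_cat ip.
  have /IHq q1 : {in fvars q, v =1 w} by move=> i ip; apply: vw; rewrite mem_cat ip orbT.
  by split=> h /p1/h/q1.
- have H a : sat [eta v with x |-> a] p <-> sat [eta w with x |-> a] p.
    apply: IHp => i ip /=; case: eqP => // /eqP ix.
    by apply: vw; rewrite mem_filter ix.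
  by split=> h a; apply/H.
Qed.

Lemma sat_fvin (Q : pred nat) v w p :
  fvin Q p -> (forall i, Q i -> v i = w i) -> sat v p <-> sat w p.
Proof. by move=> /allP pQ vw; apply: sat_eq => i /pQ /vw. Qed.

Lemma holdsE v p s : fv_lt (size s) p -> holds p s <-> sat (extend s v) p.
Proof.
move=> ps; split=> [|h w]; first exact.
rewrite (sat_fvin (w := extend s v) ps)// => i im; exact: set_nth_default.
Qed.

Lemma holds_sat v p s : fv_lt (size s) p ->
  (forall i, i < size s -> v i = nth (v i) s i) -> holds p s <-> sat v p.
Proof.
by move=> ps vs; rewrite (holdsE v ps); apply: (sat_fvin ps) => i /vs.
Qed.

Lemma sat_All v x p : sat v (All x p) <-> forall a, sat [eta v with x |-> a] p.
Proof. by []. Qed.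

Lemma sat_inst a v x p : sat v (All x p) -> sat [eta v with x |-> a] p.
Proof. exact. Qed.

Lemma sat_Imp v p q : sat v (Imp p q) <-> (sat v p -> sat v q). Proof. by []. Qed.

Lemma sat_Not v p : sat v (Not p) <-> ~ sat v p. Proof. by []. Qed.

Lemma sat_And v p q : sat v (And p q) <-> sat v p /\ sat v q.
Proof. by split=> /= [|[? ?]]; tauto || case: (EM (sat v p)); case: (EM (sat v q)); tauto. Qed.

Lemma sat_Iff v p q : sat v (Iff p q) <-> (sat v p <-> sat v q).
Proof. exact: sat_And. Qed.

Lemma sat_Ex v x p : sat v (Ex x p) <-> exists a, sat [eta v with x |-> a] p.
Proof.
split=> /= [|[a pa] /(_ a)]; last exact.
by apply: contra_notP => /forallNP.
Qed.

Lemma sat_letv v x y p : x != y ->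
  sat v (letv x y p) <-> sat [eta v with x |-> v y] p.
Proof.
move=> xy; split=> /= [|h a]; rewrite eqxx eq_sym (negbTE xy).
  exact.
by move=> ->.
Qed.

(** The sources [b i] lie outside the block that is overwritten, so the successive replacements do
    not interfere and amount to a simultaneous one. *)
Lemma sat_letblock v c m b p : (forall i, i < m -> ~~ (c <= b i < c + m)) ->
  sat v (letblock c m b p) <->
  sat (fun j => if c <= j < c + m then v (b (j - c)) else v j) p.
Proof.
elim: m p => [|m IH] p bcm /=.
  suff -> : (fun j => if c <= j < c + 0 then v (b (j - c)) else v j) = v by [].
  by apply/funext => j; case: ifP => //; lia.
rewrite IH; last by move=> i im; have := bcm i (ltnW im); lia.
rewrite sat_letv; last by have := bcm m (ltnSn m); lia.
rewrite ifF; last by have := bcm m (ltnSn m); lia.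
set w1 := (X in sat X); set w2 := (X in _ <-> sat X _).
suff -> : w1 = w2 by [].
apply/funext => j; rewrite /w1 /w2 /=; case: eqP => [->|jm].
  by rewrite addKn addnS ltnSn leq_addr.
by rewrite addnS ltnS [j <= _]leq_eqVlt (introF eqP jm).
Qed.

Lemma sat_subst v p ys : fv_lt (size ys) p ->
  sat v (subst p ys) <-> holds p [seq v y | y <- ys].
Proof.
move=> py; have ysB i : i < size ys -> nth 0 ys i < subst_base ys.
  move=> /(mem_nth 0) iy; rewrite ltnS (leq_trans _ (leq_addl _ _))// sumnE.
  by rewrite (big_rem _ iy) leq_addr.
rewrite /subst -lock sat_letblock; last by move=> i /ysB; lia.
rewrite sat_letblock; last by move=> i im; rewrite /subst_base; lia.
rewrite (holdsE v); last by rewrite size_map.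
apply: (sat_fvin py) => i im; rewrite /extend add0n im subn0 leq0n/=.
by rewrite leq_addr ltn_add2l im addKn (nth_map 0).
Qed.

End Sat.

Definition bigor (ps : seq (formula L)) :=
  foldr (fun p q => Imp (Not p) q) Bot ps.

Lemma fvin_bigor Q ps : all (fvin Q) ps -> fvin Q (bigor ps).
Proof. by elim: ps => //= p ps IH /andP[? ?]; rewrite !fvinE IH ?andbT. Qed.

Lemma sat_bigor (M : structure L) (v : nat -> M) (F : nat -> formula L) r :
  sat v (bigor [seq F i | i <- r]) <-> exists2 i, i \in r & sat v (F i).
Proof.
elim: r => [|j r IH] /=; first by split=> [//|[]].
rewrite -/(bigor _) IH; split=> [|[i]].
  have [Fj _|Fj /(_ Fj)[i ir Fi]] := EM (sat v (F j)).
    by exists j; rewrite ?mem_head.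
  by exists i; rewrite // inE ir orbT.
by rewrite inE => /predU1P[-> Fj /(_ Fj)//|ir Fi _]; exists i.
Qed.

End Syntax.

(** * Computable families of formulas *)

Section ComputableFormulas.
Variable B : nat -> bool.

(* Computability on the type [X], the inputs being represented by [rep]. *)
Definition cnat X (rep : X -> seq nat) n (g : X -> nat) : Prop :=
  exists2 f, cmp B n f & forall x, g x = f (rep x).

Section Nat.
Variables (X : Type) (rep : X -> seq nat) (n : nat).
Local Notation cn := (cnat rep n).

Lemma cnat_const c : cn (fun=> c).
Proof. by exists (fun=> c) => //; exact: cmp_const. Qed.

Lemma cnat_unary f g : cmp B 1 (fun s => f (nth 0 s 0)) -> cn g ->
  cn (fun x => f (g x)).
Proof.
move=> cf [g' cg gE]; exists (fun s => f (g' s)); first exact: cmp_unary.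
by move=> x; rewrite gE.
Qed.

Lemma cnat_binary f g h : cmp B 2 (fun s => f (nth 0 s 0) (nth 0 s 1)) ->
  cn g -> cn h -> cn (fun x => f (g x) (h x)).
Proof.
move=> cf [g' cg gE] [h' ch hE]; exists (fun s => f (g' s) (h' s)).
  exact: cmp_binary.
by move=> x; rewrite gE hE.
Qed.

Lemma cnat_succ g : cn g -> cn (fun x => (g x).+1).
Proof. by apply: cnat_unary; apply: cmp_succ; exact: cmp_nth. Qed.

Lemma cnat_add g h : cn g -> cn h -> cn (fun x => g x + h x).
Proof. by apply: cnat_binary; apply: cmp_add; exact: cmp_nth. Qed.

Lemma cnat_sub g h : cn g -> cn h -> cn (fun x => g x - h x).
Proof. by apply: cnat_binary; apply: cmp_sub; exact: cmp_nth. Qed.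

Lemma cnat_code (fs : seq (X -> nat)) :
  (forall i, i < size fs -> cn (nth (fun=> 0) fs i)) ->
  cn (fun x => CodeSeq.code [seq f x | f <- fs]).
Proof.
elim: fs => [|f fs IH] cfs; first exact: cnat_const.
apply: (@cnat_binary (fun a b => 2 ^ a * b.*2.+1) f
  (fun x => CodeSeq.code [seq f x | f <- fs])) => //; last first.
- by apply: IH => i; exact: (cfs i.+1).
- exact: (cfs 0).
apply: cmp_mul; first by apply: cmp_exp; [exact: cmp_const|exact: cmp_nth].
apply: cmp_succ; apply: (@eq_cmp _ _ (fun s => nth 0 s 1 + nth 0 s 1)).
  by move=> s _; rewrite addnn.
by apply: cmp_add; exact: cmp_nth.
Qed.

Lemma cnat_code2 f g h : cn f -> cn g -> cn h ->
  cn (fun x => CodeSeq.code [:: f x; g x; h x]).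
Proof. by move=> *; apply: (@cnat_code [:: f; g; h]) => -[|[|[]]]. Qed.

End Nat.

Lemma cnat_id n f : cmp B n f -> cnat id n f.
Proof. by exists f. Qed.

Lemma cnat_id1 : cnat (fun c => [:: c]) 1 id.
Proof. by exists (fun s => nth 0 s 0) => //; exact: cmp_nth. Qed.

Section Formulas.
Variables (L : signature) (X : Type) (rep : X -> seq nat) (n : nat).
Implicit Types F G : X -> formula L.

Definition cfm F : Prop := cnat rep n (fun x => gn (F x)).
Local Notation cn := (cnat rep n).

Lemma cfm_const p : cfm (fun=> p).
Proof. exact: cnat_const. Qed.

Lemma cfm_Imp F G : cfm F -> cfm G -> cfm (fun x => Imp (F x) (G x)).
Proof. by apply: cnat_code2; exact: cnat_const. Qed.

Lemma cfm_All i F : cn i -> cfm F -> cfm (fun x => All (i x) (F x)).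
Proof. by apply: cnat_code2; exact: cnat_const. Qed.

Lemma cfm_Eqv i j : cn i -> cn j -> cfm (fun x => Eq (Var (i x)) (Var (j x))).
Proof.
move=> ci cj; apply: cnat_code2; first exact: cnat_const.
  by apply: (@cnat_code _ _ _ [:: fun=> 0; i]) => -[|[]]// _; exact: cnat_const.
by apply: (@cnat_code _ _ _ [:: fun=> 0; j]) => -[|[]]// _; exact: cnat_const.
Qed.

Lemma cfm_Not F : cfm F -> cfm (fun x => Not (F x)).
Proof. by move=> cF; apply: cfm_Imp => //; exact: cfm_const. Qed.

Lemma cfm_And F G : cfm F -> cfm G -> cfm (fun x => And (F x) (G x)).
Proof. by move=> cF cG; apply/cfm_Not/cfm_Imp => //; exact: cfm_Not. Qed.

Lemma cfm_Iff F G : cfm F -> cfm G -> cfm (fun x => Iff (F x) (G x)).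
Proof. by move=> cF cG; apply: cfm_And; exact: cfm_Imp. Qed.

Lemma cfm_Ex i F : cn i -> cfm F -> cfm (fun x => Ex (i x) (F x)).
Proof. by move=> ci cF; apply/cfm_Not/cfm_All => //; exact: cfm_Not. Qed.

Lemma cfm_letv i j F : cn i -> cn j -> cfm F ->
  cfm (fun x => letv (i x) (j x) (F x)).
Proof. by move=> ci cj cF; apply/cfm_All/cfm_Imp => //; exact: cfm_Eqv. Qed.

Lemma cfm_letblock c m (b : X -> nat -> nat) F : cn c ->
  (forall i, i < m -> cn (b^~ i)) -> cfm F ->
  cfm (fun x => letblock (c x) m (b x) (F x)).
Proof.
move=> cc; elim: m F => [//|m IH] F cb cF.
apply: IH => [i im|]; first exact/cb/ltnW.
apply: cfm_letv; [|exact: cb|exact: cF].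
by apply: cnat_add => //; exact: cnat_const.
Qed.

(** [subst] only wraps quantifiers and equations around the formula, so the new number is computed
    from the old one without decoding. The number of variables is fixed; the variables may vary with
    [x]. *)
Lemma cfm_subst F (fs : seq (X -> nat)) :
  cfm F -> (forall i, i < size fs -> cn (nth (fun=> 0) fs i)) ->
  cfm (fun x => subst (F x) [seq f x | f <- fs]).
Proof.
move=> cF cfs.
have cB : cn (fun x => subst_base [seq f x | f <- fs]).
  apply/cnat_succ/cnat_add.
    elim: fs {cfs} => [|f fs IH]; first exact: cnat_const.
    exact: cnat_succ.
  elim: fs cfs => [|f fs IH] cfs; first exact: cnat_const.
  by apply: cnat_add; [exact: (cfs 0)|apply: IH => i; exact: (cfs i.+1)].
have -> : (fun x => subst (F x) [seq f x | f <- fs]) = (fun x =>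
    letblock (subst_base [seq f x | f <- fs]) (size fs) (nth 0 [seq f x | f <- fs])
    (letblock 0 (size fs) (addn (subst_base [seq f x | f <- fs])) (F x))).
  by apply/funext => x; rewrite /subst -lock size_map.
apply: cfm_letblock => // [i im|].
  have -> : (fun x => nth 0 [seq f x | f <- fs] i) = nth (fun=> 0) fs i.
    by apply/funext => x; rewrite (nth_map (fun=> 0)).
  exact: cfs.
apply: cfm_letblock => // [|i im]; first exact: cnat_const.
by apply: cnat_add => //; exact: cnat_const.
Qed.

Lemma cfm_subst_const F ys : cfm F -> cfm (fun x => subst (F x) ys).
Proof.
move=> cF.
have -> : (fun x => subst (F x) ys) =
    (fun x => subst (F x) [seq f x | f <- [seq (fun=> y) | y <- ys]]).
  apply/funext => x; congr subst; rewrite -map_comp -[LHS]map_id; exact: eq_map.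
apply: cfm_subst => // i; rewrite size_map => im.
by rewrite (nth_map 0)//; exact: cnat_const.
Qed.

Lemma cfm_subst3 F i j k : cfm F -> cn i -> cn j -> cn k ->
  cfm (fun x => subst (F x) [:: i x; j x; k x]).
Proof. by move=> *; apply: (@cfm_subst _ [:: i; j; k]) => // -[|[|[]]]. Qed.

End Formulas.

Lemma cmp_cfm L n (F : seq nat -> formula L) :
  cfm id n F -> cmp B n (fun s => gn (F s)).
Proof. by move=> [f cf fE]; apply: eq_cmp cf. Qed.

Definition cfamily L (F : nat -> formula L) : Prop :=
  cmp B 1 (fun s => gn (F (nth 0 s 0))).

Lemma cfm_family L (F : nat -> formula L) X (rep : X -> seq nat) n g :
  cfamily F -> cnat rep n g -> cfm rep n (fun x => F (g x)).
Proof. by move=> cF; apply: (@cnat_unary _ _ _ (fun c => gn (F c))). Qed.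

Lemma cfamilyP L (F : nat -> formula L) :
  cfm (fun c => [:: c]) 1 F -> cfamily F.
Proof.
move=> [f cf fE]; by apply: eq_cmp cf => -[|c []]//= _.
Qed.

(** A state of the loop in [cfm_iteri]: the counter, the current formula given by its number, and
    the fixed input. *)
Definition step_rep L X (rep : X -> seq nat) (z : nat * formula L * X) :=
  [:: z.1.1, gn z.1.2 & rep z.2].

Section Step.
Variables (L : signature) (X : Type) (rep : X -> seq nat) (n : nat).
Local Notation srep := (@step_rep L X rep).

Lemma cnat_step_index : cnat srep n.+2 (fun z => z.1.1).
Proof. by exists (fun s => nth 0 s 0) => //; exact: cmp_nth. Qed.

Lemma cfm_step_formula : cfm srep n.+2 (fun z => z.1.2).
Proof. by exists (fun s => nth 0 s 1) => //; exact: cmp_nth. Qed.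

Lemma cnat_step g : cnat rep n g -> cnat srep n.+2 (fun z => g z.2).
Proof.
move=> [f cf fE]; exists (fun t => f (drop 2 t)); first exact: cmp_drop2.
by move=> x; rewrite fE /= drop0.
Qed.

Lemma cfm_iteri (m : X -> nat) (a : X -> formula L)
    (F : nat -> formula L -> X -> formula L) :
  cnat rep n m -> cfm rep n a ->
  cfm srep n.+2 (fun z => F z.1.1 z.1.2 z.2) ->
  cfm rep n (fun x => iteri (m x) (fun i p => F i p x) (a x)).
Proof.
move=> [m' cm mE] [a' ca aE] [F' cF FE].
exists (fun s => iteri (m' s) (fun i y => F' [:: i, y & s]) (a' s)).
  apply: (@cmp_iteri _ _ _ _ (fun i y s => F' [:: i, y & s])) => //.
  by apply: eq_cmp cF => -[|? [|? ?]]//= _; rewrite drop0.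
move=> x; rewrite -mE; elim: (m x) => [|i /= <-]; first exact: aE.
exact: (FE (i, _, x)).
Qed.

End Step.
End ComputableFormulas.

(** * Decoding formula numbers with the oracle [Th M] *)

Section Decoding.
Variable L : signature.

(** Made total by the default [Bot], so that every natural number is the index of a formula in the
    variables below [n]. *)
Definition dec n c : formula L :=
  match pselect (exists p : formula L, fv_lt n p /\ gn p = c) with
  | left h => projT1 (cid h)
  | right _ => Bot
  end.

Lemma dec_fv n c : fv_lt n (dec n c).
Proof. by rewrite /dec; case: pselect => // h; case: cid => p []. Qed.

Lemma gnK n p : fv_lt n p -> dec n (gn p) = p.
Proof.
move=> np; rewrite /dec; case: pselect => [h|[]]; last by exists p.
by case: cid => q /= [_ /gn_inj].
Qed.

Fixpoint uclose n (p : formula L) := if n is m.+1 then All m (uclose m p) else p.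

(* Universal closure of [p -> p], for [p] with number [c]. It belongs to [Th M]
   iff there is such a [p], so that the oracle recognizes Goedel numbers even
   though the signature is not effective. *)
Definition taut_code n c :=
  iteri n (fun i y => CodeSeq.code [:: 4; i; y]) (CodeSeq.code [:: 3; c; c]).

Lemma gn_uclose n p : gn (uclose n (Imp p p)) = taut_code n (gn p).
Proof. by elim: n => //= n ->. Qed.

Lemma gn_eq_taut_code n c q : gn q = taut_code n c ->
  exists2 p, gn p = c & q = uclose n (Imp p p).
Proof.
have code_inj : injective CodeSeq.code := can_inj CodeSeq.codeK.
elim: n q => [|n IH] [t u|r ts||p q|x p] //= /code_inj // [].
  by move=> <- /gn_inj <-; exists q.
by move=> -> /IH[q <- ->]; exists q.
Qed.

Lemma fvin_uclose Q n p : fvin Q (uclose n p) = fvin (fun y => (y < n) || Q y) p.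
Proof.
elim: n Q => //= n IH Q; rewrite fvin_All IH; apply: eq_all => y.
by rewrite ltnS implybE negbK [in RHS]leq_eqVlt orbCA orbA.
Qed.

Lemma sat_uclose (M : structure L) (v : nat -> M) n p :
  (forall w : nat -> M, sat w p) -> sat v (uclose n p).
Proof. by elim: n v => //= n IH v h a; exact: IH. Qed.

Lemma Th_gn (M : structure L) p : fv_lt 0 p -> Th M (gn p) <-> holds (M := M) p [::].
Proof.
move=> p0; split=> [/asboolP[q [_ qh /gn_inj <-]]//|ph].
by apply/asboolP; exists p.
Qed.

Lemma Th_taut_code (M : structure L) n c :
  Th M (taut_code n c) = `[< exists p : formula L, fv_lt n p /\ gn p = c >].
Proof.
apply/idP/idP => [/asboolP[q [q0 _ /gn_eq_taut_code[p pc qE]]]|/asboolP[p [pn <-]]].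
  apply/asboolP; exists p; split=> //; move: q0.
  rewrite qE fv_ltE fvin_uclose fvinE andbb; apply: sub_fvin => i.
  by rewrite orbF.
rewrite -gn_uclose; apply/(Th_gn M) => [|v]; last by apply: sat_uclose => w.
by rewrite fv_ltE fvin_uclose fvinE andbb; apply: sub_fvin pn => i ->.
Qed.

(** On numbers, decoding inspects no formula: [c] is kept or replaced according to one oracle
    query. *)
Lemma gn_dec (M : structure L) n c :
  gn (dec n c) = if Th M (taut_code n c) then c else gn (@Bot L).
Proof.
rewrite Th_taut_code /dec; case: pselect => [h|h].
  by rewrite (asboolT h); case: cid => p [].
by rewrite (asboolF h).
Qed.

Lemma cfm_dec (M : structure L) X (rep : X -> seq nat) n f g :
  cnat (Th M) rep n f -> cnat (Th M) rep n g ->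
  cfm (Th M) rep n (fun x => dec (f x) (g x)).
Proof.
apply: (@cnat_binary _ _ _ _ (fun i c => gn (dec i c))).
apply: (@eq_cmp _ _ (fun s => if Th M (taut_code (nth 0 s 0) (nth 0 s 1))
  then nth 0 s 1 else gn (@Bot L))) => [s _|]; first by rewrite -gn_dec.
apply: cmp_if; [apply: cmp_oracle|exact: cmp_nth|exact: cmp_const].
apply: (@cmp_iteri _ _ _ _ (fun i y _ => CodeSeq.code [:: 4; i; y])).
- exact: cmp_nth.
- apply: (@cmp_code _ _ [:: fun=> 3; fun s => nth 0 s 1; fun s => nth 0 s 1]).
  by case=> [|[|[]]]// _; [exact: cmp_const|exact: cmp_nth..].
- apply: (@cmp_code _ _ [:: fun=> 4; fun s => nth 0 s 0; fun s => nth 0 s 1]).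
  by case=> [|[|[]]]// _; [exact: cmp_const|exact: cmp_nth..].
Qed.

End Decoding.

Ltac cfm_step := match goal with
  | |- cnat _ _ _ (fun=> _) => exact: cnat_const
  | |- cfm _ _ _ (fun x => And (@?a x) (@?b x)) => apply: (@cfm_And _ _ _ _ _ a b)
  | |- cfm _ _ _ (fun x => Iff (@?a x) (@?b x)) => apply: (@cfm_Iff _ _ _ _ _ a b)
  | |- cfm _ _ _ (fun x => Imp (@?a x) (@?b x)) => apply: (@cfm_Imp _ _ _ _ _ a b)
  | |- cfm _ _ _ (fun x => Not (@?a x)) => apply: (@cfm_Not _ _ _ _ _ a)
  | |- cfm _ _ _ (fun x => All (@?a x) (@?b x)) => apply: (@cfm_All _ _ _ _ _ a b)
  | |- cfm _ _ _ (fun x => Ex (@?a x) (@?b x)) => apply: (@cfm_Ex _ _ _ _ _ a b)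
  | |- cfm _ _ _ (fun x => Eq (Var (@?a x)) (Var (@?b x))) =>
      apply: (@cfm_Eqv _ _ _ _ _ a b)
  | |- cfm _ _ _ (fun x => subst (@?a x) ?ys) =>
      apply: (@cfm_subst_const _ _ _ _ _ a ys)
  | |- cfm _ _ _ (fun x => dec _ (@?a x) (@?b x)) => apply: (@cfm_dec _ _ _ _ _ a b)
  | |- cfm _ _ _ (fun=> _) => exact: cfm_const
  end.

(** * Coding tuples of parameters *)

Section Pairing.
Variables (L : signature) (M : structure L).
Variables (pr : M -> M -> M) (prF : formula L) (z0 : M).
Hypothesis pr_inj : forall a b c d, pr a b = pr c d -> a = c /\ b = d.
Hypothesis prF_fv : fv_lt 3 prF.
Hypothesis prFP : forall a b c, holds prF [:: a; b; c] <-> c = pr a b.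
Implicit Types (p q : formula L) (s t : seq M) (v : nat -> M).

Lemma sat_prF v i j k :
  sat v (subst prF [:: i; j; k]) <-> v k = pr (v i) (v j).
Proof. by rewrite sat_subst//; exact: prFP. Qed.

Lemma fvin_prF (Q : pred nat) i j k : Q i -> Q j -> Q k ->
  fvin Q (subst prF [:: i; j; k]).
Proof. by move=> ? ? ?; apply: fvin_subst => //=; apply/and4P. Qed.

Fixpoint tup s : M :=
  match s with
  | [::] => z0
  | [:: a] => a
  | a :: t => pr a (tup t)
  end.

Lemma tup_cons a s : 0 < size s -> tup (a :: s) = pr a (tup s).
Proof. by case: s. Qed.

(** The nesting is to the right, so the last two entries form an innermost pair; splitting the last
    variable by [estep] preserves the coded tuple. *)
Lemma tup_rcons2 s a b : tup (rcons (rcons s a) b) = tup (rcons s (pr a b)).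
Proof. by elim: s => // c s IH; rewrite !rcons_cons !tup_cons ?size_rcons ?IH. Qed.

Lemma tup_inj s t : size s = size t -> tup s = tup t -> s = t.
Proof.
elim: s t => [|a s IH] [|c t] // [st].
case: s st IH => [|b s] st IH; first by case: t st => // _ /= ->.
by rewrite (tup_cons a)// (tup_cons c) -?st// => /pr_inj[-> /IH ->].
Qed.

(* [cstep m] replaces the variables [m] and [m + 1] by the single variable [m],
   coding a pair; [estep m] does the converse. *)
Definition cstep m p :=
  Ex m.+1 (Ex m.+2 (And (subst prF [:: m.+2; m.+1; m]) (letv m m.+2 p))).

Definition estep m p :=
  Ex m.+2 (And (subst prF [:: m; m.+1; m.+2]) (letv m m.+2 p)).

Lemma cstep_fv m p : fv_lt m.+2 p -> fv_lt m.+1 (cstep m p).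
Proof.
move=> pm; rewrite fv_ltE !fvinE; apply/and3P; split.
  by apply: fvin_prF; apply/implyP => //; apply/implyP=> //; lia.
  by lia.
by apply: sub_fvin pm => i; lia.
Qed.

Lemma estep_fv m p : fv_lt m.+1 p -> fv_lt m.+2 (estep m p).
Proof.
move=> pm; rewrite fv_ltE !fvinE; apply/and3P; split.
  by apply: fvin_prF; apply/implyP => //; lia.
  by lia.
by apply: sub_fvin pm => i; lia.
Qed.

Lemma holds_cstep m p s w : size s = m -> fv_lt m.+2 p ->
  holds (cstep m p) (rcons s w) <->
  exists a b, w = pr a b /\ holds p (rcons (rcons s a) b).
Proof.
move=> sm pm; pose v0 (_ : nat) := w.
rewrite (holdsE v0) ?size_rcons ?sm ?cstep_fv//.
have vm : extend (rcons s w) v0 m = w by rewrite /extend nth_rcons sm ltnn eqxx.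
(* The variables [m] and [m.+1] receive [a] and [b]; the auxiliary [m.+2] is not free in [p]. *)
have key a b : sat [eta [eta [eta extend (rcons s w) v0 with m.+1 |-> b]
    with m.+2 |-> a] with m |-> a] p <-> holds p (rcons (rcons s a) b).
  apply: iff_sym; apply: holds_sat; rewrite ?size_rcons ?sm// => i im /=.
  rewrite !nth_rcons size_rcons sm /extend nth_rcons sm.
  move: im; rewrite ltnS leq_eqVlt => /predU1P[->|].
    by rewrite ltnn !eqxx; do ![case: eqP => [?|_]; first by exfalso; lia].
  rewrite ltnS leq_eqVlt => /predU1P[->|im].
    by rewrite eqxx ltnn.
  do ![case: eqP => [?|_]; first by exfalso; lia].
  by rewrite im; apply: set_nth_default; rewrite sm.
rewrite /cstep sat_Ex; split=> [[b]|[a [b [wE pab]]]].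
  rewrite sat_Ex => -[a]; rewrite sat_And sat_prF sat_letv; last by lia.
  rewrite /= !eqxx; do ![case: eqP => [?|_]; first by exfalso; lia].
  by rewrite vm key => -[? ?]; exists a, b.
exists b; rewrite sat_Ex; exists a; rewrite sat_And sat_prF sat_letv; last by lia.
rewrite /= !eqxx; do ![case: eqP => [?|_]; first by exfalso; lia].
by rewrite vm key.
Qed.

Lemma holds_estep m p s a c : size s = m -> fv_lt m.+1 p ->
  holds (estep m p) (rcons (rcons s a) c) <-> holds p (rcons s (pr a c)).
Proof.
move=> sm pm; pose v0 (_ : nat) := a.
set s' := rcons (rcons s a) c.
rewrite (holdsE v0) ?size_rcons ?sm ?estep_fv//.
have vm : extend s' v0 m = a.
  by rewrite /extend !nth_rcons size_rcons sm ltnSn ltnn eqxx.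
have vm1 : extend s' v0 m.+1 = c.
  by rewrite /extend !nth_rcons size_rcons sm ltnn eqxx.
have key b : sat [eta [eta extend s' v0 with m.+2 |-> b] with m |-> b] p <->
    holds p (rcons s b).
  apply: iff_sym; apply: holds_sat; rewrite ?size_rcons ?sm// => i im /=.
  rewrite /extend !nth_rcons size_rcons sm.
  move: im; rewrite ltnS leq_eqVlt => /predU1P[->|im].
    by rewrite eqxx ltnn.
  do ![case: eqP => [?|_]; first by exfalso; lia].
  by rewrite im; apply: set_nth_default; rewrite sm.
rewrite /estep sat_Ex; split=> [[b]|pac].
  rewrite sat_And sat_prF sat_letv; last by lia.
  rewrite /= !eqxx; do ![case: eqP => [?|_]; first by exfalso; lia].
  by rewrite vm vm1 key => -[->].
exists (pr a c); rewrite sat_And sat_prF sat_letv; last by lia.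
rewrite /= !eqxx; do ![case: eqP => [?|_]; first by exfalso; lia].
by rewrite vm vm1 key.
Qed.

(** The [K.+1] parameters occupy the variables [N, ..., N + K]. The last two are merged first, and
    the position of the merge moves down to [N]. *)
Definition compress N K p :=
  iteri K (fun j q => cstep (N + (K - j.+1)) q) p.

(** Variable [1] is unpacked into [1, ..., K.+1], each step splitting the last variable. *)
Definition expand K p := iteri K (fun j q => estep j.+1 q) p.

Lemma compressP N K p : fv_lt (N + K.+1) p ->
  fv_lt N.+1 (compress N K p) /\ forall s w, size s = N ->
    (holds (compress N K p) (rcons s w) <->
     exists t, [/\ size t = K.+1, w = tup t & holds p (s ++ t)]).
Proof.
(* After [i] merges the last variable is [N + (K - i)] and holds the code of the last [i.+1]
   parameters. *)
move=> pN; pose Q i := iteri i (fun j q => cstep (N + (K - j.+1)) q) p.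
suff H i : i <= K -> fv_lt (N + (K - i)).+1 (Q i) /\
    forall s w, size s = N + (K - i) -> (holds (Q i) (rcons s w) <->
      exists t, [/\ size t = i.+1, w = tup t & holds p (s ++ t)]).
  by have := H K (leqnn K); rewrite subnn addn0.
elim: i => [_|i IH iK].
  rewrite subn0 -addnS; split=> // s w sN; split=> [h|].
    by exists [:: w]; rewrite cats1.
  by move=> [[|a [|? ?]] []//= _ ->]; rewrite cats1.
have [Qi QiP] := IH (ltnW iK).
have e : N + (K - i) = (N + (K - i.+1)).+1 by lia.
rewrite e in Qi QiP; split; first exact: cstep_fv.
move=> s w sN; rewrite holds_cstep//; split=> [[a [b [-> /QiP]]]|].
  rewrite size_rcons sN => -[//|t [ti -> pt]]; exists (a :: t).
  by split; [rewrite /= ti|rewrite tup_cons ?ti|rewrite -cat_rcons].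
move=> [[|a t] []// [ti] wE pt]; exists a, (tup t); split.
  by rewrite wE tup_cons ?ti.
by apply/QiP; rewrite ?size_rcons ?sN//; exists t; rewrite cat_rcons.
Qed.

Lemma expandP K p : fv_lt 2 p -> fv_lt K.+2 (expand K p) /\
  forall b t, size t = K.+1 -> (holds (expand K p) (b :: t) <->
    holds p [:: b; tup t]).
Proof.
move=> p2; elim: K => [|K [IH1 IH2]]; first by split=> // b [|a []].
split=> [|b]; first exact: estep_fv.
elim/last_ind => // t c _; elim/last_ind: t => // t a _.
rewrite !size_rcons => -[tK]; rewrite -!rcons_cons holds_estep//=; last first.
  by rewrite tK.
by rewrite IH2 ?size_rcons ?tK// tup_rcons2.
Qed.

(** The parameters are merged by the pairing function; a set defined without parameters gets the
    dummy [z0]. *)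
Lemma definable_one_parameter n (S : set (n.-tuple M)) : definable S ->
  exists2 p, fv_lt n.+1 p &
    exists u : M, forall x : n.-tuple M, S x <-> holds p (rcons x u).
Proof.
move=> [[|K] [a [p [pn SP]]]].
  exists p; first by apply: fv_lt_leq pn; rewrite addn0.
  exists z0 => x; rewrite SP; rewrite addn0 in pn.
  rewrite [tval a]size0nil ?size_tuple// cats0.
  rewrite (holdsE (fun=> z0)) ?size_tuple//.
  rewrite (holdsE (fun=> z0)) ?size_rcons ?size_tuple//; last exact: fv_lt_leq pn.
  by apply: (sat_fvin pn) => i im; rewrite /extend nth_rcons size_tuple im.
have [cn cP] := compressP pn; exists (compress n K p) => //.
exists (tup a) => x; rewrite SP cP ?size_tuple//; split=> [h|[t [tK + h]]].
  by exists a; rewrite size_tuple.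
by move=> /tup_inj ->//; rewrite size_tuple.
Qed.

(** Elimination of imaginaries gives a map into some power of [M]; coding its values by [tup], which
    is injective at a fixed length, gives a map into [M] with the same kernel. *)
Lemma unary_EI : uniform_EI M -> forall th, fv_lt 2 th ->
  exists2 F, fv_lt 2 F & exists f : M -> M,
    (forall z u, holds F [:: z; u] <-> z = f u) /\
    forall u u', f u = f u' <->
      (forall x, holds th [:: x; u] <-> holds th [:: x; u']).
Proof.
move=> EI th th2.
pose E (z y : 1.-tuple M) :=
  forall x, holds th [:: x; thead z] <-> holds th [:: x; thead y].
have E_equiv : RelationClasses.Equivalence E.
  split=> [z x|z y zy x|a b c ab bc x] //; first by symmetry; exact: zy.
  by transitivity (holds th [:: x; thead b]); [exact: ab|exact: bc].
have E_def : definable0_rel E.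
  exists (All 2 (Iff (subst th [:: 2; 0]) (subst th [:: 2; 1]))).
    rewrite fv_ltE !fvinE; apply/andP.
    by split; apply: fvin_subst.
  move=> w; have -> : tval w = [:: tnth w ord0; tnth w (lift ord0 ord0)].
    apply: (@eq_from_nth _ z0); first by rewrite size_tuple.
    by rewrite size_tuple => -[|[|i]] i2; rewrite ?(tnth_nth z0)//.
  set a := tnth w _; set b := tnth w _.
  have satE : holds (All 2 (Iff (subst th [:: 2; 0]) (subst th [:: 2; 1])))
      [:: a; b] <-> forall x, holds th [:: x; a] <-> holds th [:: x; b].
    split=> [h x|h v].
      by have /sat_All/(_ x) := h (fun=> z0); rewrite sat_Iff !sat_subst.
    by apply/sat_All => x; rewrite sat_Iff !sat_subst//; exact: h.
  rewrite satE; split=> [[[z y] zyE wE] x|h].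
    by have := zyE x; rewrite /a /b -wE /thead !(tnth_nth z0) /= !nth_cat !size_tuple.
  exists ([tuple a], [tuple b]) => //.
  apply: eq_from_tnth => i; rewrite !(tnth_nth z0).
  by case: i => -[|[|]]//= _; rewrite /a /b (tnth_nth z0).
have [m [f [m_gt0 [p pK fP] fE]]] := EI 1 E E_equiv E_def.
case: m f m_gt0 p pK fP fE => // K f _ p pK fP fE.
have [q2 qP] := @compressP 1 K p pK.
(* The graph [p] lists the argument first, whereas [F] has the value first; hence the swap. *)
exists (subst (compress 1 K p) [:: 1; 0]); first exact: fvin_subst.
have pE u t : size t = K.+1 -> holds p (u :: t) <-> t = f [tuple u].
  move=> /eqP tK; have := fP [tuple of [tuple u] ++ Tuple tK]; rewrite /= => <-.
  split=> [[z _]|tf]; last by exists [tuple u] => //; apply: val_inj => /=; rewrite tf.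
  move=> /(congr1 val) /= e; have <- : z = [tuple u].
    apply: eq_from_tnth => i; rewrite (ord1 i) !(tnth_nth z0) /=.
    by have := congr1 (nth z0 ^~ 0) e; rewrite nth_cat size_tuple.
  have := congr1 (drop 1) e.
  by rewrite drop_size_cat ?size_tuple//= drop0.
exists (fun u => tup (f [tuple u])); split=> [z u|u u'].
  rewrite (holdsE (fun=> z0)); last exact: fvin_subst.
  rewrite sat_subst// (qP [:: u] z erefl); split=> [[t [tK -> /(pE _ _ tK) ->]]//|->].
  exists (f [tuple u]); split; rewrite ?size_tuple//.
  by apply/pE; rewrite ?size_tuple.
split=> [/tup_inj e|h]; last by have /fE -> : E [tuple u] [tuple u'] by exact: h.
by have /fE : f [tuple u] = f [tuple u'] by apply/val_inj/e; rewrite !size_tuple.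
Qed.

Section Computability.
Variables (B : nat -> bool) (X : Type) (rep : X -> seq nat) (n : nat).
Local Notation cn := (cnat B rep n).
Local Notation cf := (cfm B rep n).

Lemma cfm_prF i j k : cn i -> cn j -> cn k ->
  cf (fun x => subst prF [:: i x; j x; k x]).
Proof. by apply: cfm_subst3; exact: cfm_const. Qed.

Lemma cfm_cstep m F : cn m -> cf F -> cf (fun x => cstep (m x) (F x)).
Proof.
move=> cm cF; have cm1 := cnat_succ cm; have cm2 := cnat_succ cm1.
apply/cfm_Ex/cfm_Ex/cfm_And => //; first exact: cfm_prF.
exact: cfm_letv.
Qed.

Lemma cfm_estep m F : cn m -> cf F -> cf (fun x => estep (m x) (F x)).
Proof.
move=> cm cF; have cm1 := cnat_succ cm; have cm2 := cnat_succ cm1.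
apply/cfm_Ex/cfm_And => //; first exact: cfm_prF.
exact: cfm_letv.
Qed.

End Computability.

Lemma cfm_compress B X (rep : X -> seq nat) n N K F :
  cnat B rep n N -> cnat B rep n K -> cfm B rep n F ->
  cfm B rep n (fun x => compress (N x) (K x) (F x)).
Proof.
move=> cN cK cF.
apply: (@cfm_iteri _ _ _ _ _ _ _ (fun j q x => cstep (N x + (K x - j.+1)) q)) => //.
apply: cfm_cstep; last exact: cfm_step_formula.
apply: cnat_add; first exact: cnat_step.
apply: cnat_sub; first exact: cnat_step.
by apply: cnat_succ; exact: cnat_step_index.
Qed.

Lemma cfm_expand B X (rep : X -> seq nat) n K F :
  cnat B rep n K -> cfm B rep n F ->
  cfm B rep n (fun x => expand (K x) (F x)).
Proof.
move=> cK cF.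
apply: (@cfm_iteri _ _ _ _ _ _ _ (fun j q _ => estep j.+1 q)) => //.
apply: cfm_estep; last exact: cfm_step_formula.
by apply: cnat_succ; exact: cnat_step_index.
Qed.

(** * The extension function *)

Section Extension.
Variables (zF oF : formula L) (o1 : M).
Hypothesis zF_fv : fv_lt 1 zF.
Hypothesis oF_fv : fv_lt 1 oF.
Hypothesis zFP : forall a, holds zF [:: a] <-> a = z0.
Hypothesis oFP : forall a, holds oF [:: a] <-> a = o1.
Hypothesis z0o1 : z0 <> o1.
Hypothesis M_EI : uniform_EI M.

(* [F(z, u)] is the graph of a function [u |-> z] whose kernel is the relation
   "[th(., u)] and [th(., u')] define the same set". *)
Definition kernel_spec th F : formula L :=
  And (All 1 (Ex 0 (subst F [:: 0; 1])))
  (And (All 1 (All 2 (All 3 (Imp (subst F [:: 2; 1]) (Imp (subst F [:: 3; 1])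
     (Eq (Var 2) (Var 3)))))))
  (All 1 (All 2 (Iff (Ex 3 (And (subst F [:: 3; 1]) (subst F [:: 3; 2])))
     (All 0 (Iff (subst th [:: 0; 1]) (subst th [:: 0; 2]))))))).

Definition kernel_graph th F (f : M -> M) : Prop :=
  (forall z u, holds F [:: z; u] <-> z = f u) /\
  forall u u', f u = f u' <->
    (forall x, holds th [:: x; u] <-> holds th [:: x; u']).

Lemma kernel_spec_fv th F : fv_lt 2 th -> fv_lt 2 F -> fv_lt 0 (kernel_spec th F).
Proof.
by move=> th2 F2; rewrite fv_ltE /kernel_spec !fvinE /= !fvin_subst.
Qed.

(** Being a kernel function for [th] is thus a single sentence, to be tested by one query to [Th M].
    In it, equality of two values is expressed by a common [z] in the graph. *)
Lemma holds_kernel_spec th F : fv_lt 2 th -> fv_lt 2 F ->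
  holds (M := M) (kernel_spec th F) [::] <-> exists f, kernel_graph th F f.
Proof.
move=> th2 F2; rewrite (holdsE (fun=> z0)) ?kernel_spec_fv//.
have same v : sat v (All 0 (Iff (subst th [:: 0; 1]) (subst th [:: 0; 2]))) <->
    forall x, holds th [:: x; v 1] <-> holds th [:: x; v 2].
  rewrite sat_All; split=> h x; have := h x; first by rewrite sat_Iff !sat_subst.
  by rewrite sat_Iff !sat_subst.
have meet v : sat v (Ex 3 (And (subst F [:: 3; 1]) (subst F [:: 3; 2]))) <->
    exists z, holds F [:: z; v 1] /\ holds F [:: z; v 2].
  rewrite sat_Ex; split=> -[z]; rewrite ?sat_And ?sat_subst// => h; exists z => //.
  by rewrite sat_And !sat_subst.
rewrite /kernel_spec !sat_And; split.
  move=> [F_tot [F_fun F_ker]].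
  have [f fP] : exists f : M -> M, forall u, holds F [:: f u; u].
    have H (u : M) : exists z, holds F [:: z; u].
      have /(sat_inst u)/sat_Ex[z] := F_tot; rewrite sat_subst// => Fz.
      by exists z.
    by have [f fP] := choice H; exists f.
  have fE (z u : M) : holds F [:: z; u] <-> z = f u.
    split=> [Fz|->//].
    have /(sat_inst u)/(sat_inst z)/(sat_inst (f u)) := F_fun.
    by rewrite !sat_Imp !sat_subst// => h; exact: h Fz (fP u).
  exists f; split=> // u u'.
  have /(sat_inst u)/sat_All/(_ u') := F_ker; rewrite sat_Iff same meet /= => <-.
  split=> [e|[z [/fE <- /fE <-]]//].
  by exists (f u); split=> //; apply/fE.
move=> [f [fE f_ker]]; split; [|split].
- apply/sat_All => u; apply/sat_Ex; exists (f u); rewrite sat_subst//.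
  exact/fE.
- apply/sat_All => u; apply/sat_All => z; apply/sat_All => z'.
  by rewrite !sat_Imp !sat_subst// => /fE /= -> /fE.
- apply/sat_All => u; apply/sat_All => u'; rewrite sat_Iff same meet /= -f_ker.
  split=> [[z [/fE <- /fE <-]]//|e].
  by exists (f u); split; apply/fE.
Qed.

Local Notation B := (Th M).

Lemma kernel_spec_ex c :
  exists d, Th M (gn (kernel_spec (dec L 2 c) (dec L 2 d))).
Proof.
have [F F2 fP] := unary_EI M_EI (dec_fv L 2 c).
exists (gn F); rewrite gnK//; apply/(Th_gn M).
  by apply: kernel_spec_fv => //; exact: dec_fv.
by apply/holds_kernel_spec => //; exact: dec_fv.
Qed.

(** The least index meeting the specification is what an unbounded search with oracle [Th M] finds;
    elimination of imaginaries guarantees that the search halts. *)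
Definition kerF c : formula L := dec L 2 (ex_minn (kernel_spec_ex c)).

Lemma kerF_fv c : fv_lt 2 (kerF c). Proof. exact: dec_fv. Qed.

Lemma ker_ex c : exists f, kernel_graph (dec L 2 c) (kerF c) f.
Proof.
apply/holds_kernel_spec; try exact: dec_fv.
rewrite /kerF; case: ex_minnP => d /(Th_gn M) + _; apply.
by apply: kernel_spec_fv; exact: dec_fv.
Qed.

Definition ker c : M -> M := projT1 (cid (ker_ex c)).

Lemma kerP c : kernel_graph (dec L 2 c) (kerF c) (ker c).
Proof. by rewrite /ker; case: cid. Qed.

(* The values [tag c z], for distinct [c], lie in disjoint copies of [M]. *)
Definition tag c z := iter c (pr o1) (pr z0 z).

(** First components spell [c] in unary, as [c] copies of [o1] followed by [z0]; since [z0 <> o1],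
    both [c] and [z] can be read off. *)
Lemma tag_inj c d z y : tag c z = tag d y -> c = d /\ z = y.
Proof.
elim: c d => [|c IH] [|d] /= /pr_inj[]; first by [].
- by move/z0o1.
- by move/esym/z0o1.
- by move=> _ /IH[-> ->].
Qed.

(** Base case of a formula for [b = tag c z], with [b] in variable [0] and [z] in variable [1]. The
    formulas [zF] and [oF] define [z0] and [o1], so no parameters enter. *)
Definition tag0 : formula L := Ex 2 (And (subst zF [:: 2]) (subst prF [:: 2; 1; 0])).

Definition tagS p : formula L := Ex 2 (Ex 3 (And (subst oF [:: 2])
  (And (subst prF [:: 2; 3; 0]) (subst p [:: 3; 1])))).

Definition tagF c : formula L := iteri c (fun _ => tagS) tag0.

Lemma tagF_fv c : fv_lt 2 (tagF c).
Proof.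
case: c => [|c]; first by rewrite fv_ltE !fvinE !fvin_subst.
elim: c => [|c IH] /=; rewrite fv_ltE !fvinE !fvin_subst//.
by rewrite fv_ltE !fvinE !fvin_subst.
Qed.

Lemma holds_tagF c b z : holds (tagF c) [:: b; z] <-> b = tag c z.
Proof.
elim: c b => [|c IH] b; rewrite (holdsE (fun=> z0)) ?tagF_fv//.
  rewrite sat_Ex; split=> [[a]|->].
    by rewrite sat_And sat_prF sat_subst// /extend /= => -[/zFP -> ->].
  by exists z0; rewrite sat_And sat_prF sat_subst//; split=> //; apply/zFP.
rewrite sat_Ex; split=> [[a /sat_Ex[w]]|->].
  rewrite !sat_And sat_prF !sat_subst//; last exact: tagF_fv.
  by rewrite /extend /= => -[/oFP -> [-> /IH ->]].
exists o1; rewrite sat_Ex; exists (tag c z).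
rewrite !sat_And sat_prF !sat_subst//; last exact: tagF_fv.
by split; [apply/oFP|split=> //; apply/IH].
Qed.

(** * The extension of a set, as a relation and by formulas *)

Definition codes c u (S : M -> Prop) :=
  forall x, S x <-> holds (dec L 2 c) [:: x; u].

(** Minimality of [c] removes the choice of a formula, and [ker c] the choice of its parameter, so
    that [b] depends on [S] alone. *)
Definition is_ext (S : M -> Prop) b := exists c u,
  [/\ codes c u S, forall j, j < c -> forall w, ~ codes j w S & b = tag c (ker c u)].

Lemma is_ext_uniq S b b' : is_ext S b -> is_ext S b' -> b = b'.
Proof.
move=> [c [u [cu c_min ->]]] [d [w [dw d_min ->]]].
have cd : c = d.
  by have [/d_min/(_ _ cu)|/c_min/(_ _ dw)|] := ltngtP c d.
case: d / cd dw d_min => cw _; congr tag; apply/(kerP c).2 => x.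
by rewrite -cu -cw.
Qed.

(** The core of Basic Law V: equal values carry equal tags, hence come from the same formula, and
    equal kernel values then mean that it defines the same set. *)
Lemma is_ext_inj S S' b : is_ext S b -> is_ext S' b -> forall x, S x <-> S' x.
Proof.
move=> [c [u [cu _ ->]]] [d [w [dw _ /tag_inj[cd]]]].
case: d / cd dw => cw /(kerP c).2 uw x.
by rewrite cu cw.
Qed.

Lemma is_ext_ex c u S : codes c u S -> exists b, is_ext S b.
Proof.
elim/ltn_ind: c u => c IH u cu.
have [[j [jc [w /(IH _ jc)//]]]|c_min] := EM (exists j, j < c /\ exists w, codes j w S).
exists (tag c (ker c u)), c, u; split=> // j jc w jw; apply: c_min.
by exists j; split=> //; exists w.
Qed.

Lemma eq_is_ext S S' b : (forall x, S x <-> S' x) -> is_ext S b -> is_ext S' b.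
Proof. by move=> SS; have -> : S = S' by apply/predeqP. Qed.

(* The variables 1 and 2 are parameters for the formulas number [c] and [j]. *)
Definition same j c : formula L :=
  All 4 (Iff (subst (dec L 2 j) [:: 4; 2]) (subst (dec L 2 c) [:: 4; 1])).

Definition hasF j c : formula L := Ex 2 (same j c).

Definition valF j c : formula L := Ex 2 (Ex 3 (And (same j c)
  (And (subst (kerF j) [:: 3; 2]) (subst (tagF j) [:: 0; 3])))).

(** Step [i] tests the number [c - i], so in [extF] the outermost test concerns [0] and the first
    success is the least. The number [c] itself succeeds, so the final [Bot] is never reached. *)
Definition ext_step c i p : formula L :=
  And (Imp (hasF (c - i) c) (valF (c - i) c)) (Imp (Not (hasF (c - i) c)) p).

Definition extF c : formula L := iteri c.+1 (ext_step c) Bot.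

Lemma extF_fv c : fv_lt 2 (extF c).
Proof.
rewrite /extF; elim: c.+1 => //= i IH.
by rewrite fv_ltE !fvinE !fvin_subst ?dec_fv ?kerF_fv ?tagF_fv.
Qed.

Lemma sat_same v j c :
  sat v (same j c) <-> codes j (v 2) (fun x => holds (dec L 2 c) [:: x; v 1]).
Proof.
rewrite sat_All; split=> h x; have := h x;
  by rewrite sat_Iff !sat_subst ?dec_fv//= => ->.
Qed.

Lemma sat_hasF v j c : sat v (hasF j c) <->
  exists w, codes j w (fun x => holds (dec L 2 c) [:: x; v 1]).
Proof. by rewrite sat_Ex; split=> -[w h]; exists w; exact/(sat_same [eta v with 2 |-> w]). Qed.

Lemma sat_valF v j c : sat v (valF j c) <-> exists w,
  codes j w (fun x => holds (dec L 2 c) [:: x; v 1]) /\ v 0 = tag j (ker j w).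
Proof.
rewrite sat_Ex; split=> [[w /sat_Ex[z]]|[w [jw vE]]].
  rewrite !sat_And sat_same !sat_subst ?kerF_fv ?tagF_fv// /= => -[jw [zw]].
  by move=> /holds_tagF ->; exists w; split=> //; rewrite ((kerP j).1 z w).1.
exists w; rewrite sat_Ex; exists (ker j w).
rewrite !sat_And sat_same !sat_subst ?kerF_fv ?tagF_fv//=; split=> //; split.
  exact/(kerP j).1.
exact/holds_tagF.
Qed.

Lemma sat_extF v c :
  sat v (extF c) <-> is_ext (fun x => holds (dec L 2 c) [:: x; v 1]) (v 0).
Proof.
set S := fun x => _.
(* After [i] steps the formula selects the least suitable number among [c.+1 - i, ..., c]. *)
suff H i : i <= c.+1 -> sat v (iteri i (ext_step c) Bot) <-> exists j u,
    [/\ c.+1 - i <= j <= c, codes j u S,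
      forall j', c.+1 - i <= j' < j -> forall w, ~ codes j' w S &
      v 0 = tag j (ker j u)].
  rewrite /extF H// subnn; split=> [[j [u [_ ju j_min ->]]]|[j [u [ju j_min ->]]]].
    by exists j, u.
  (* The least number is at most [c], since [c] codes [S] with the parameter [v 1]. *)
  exists j, u; split=> //; rewrite leq0n leqNgt; apply/negP => cj.
  by apply: (j_min c cj (v 1)) => x.
elim: i => [_|i IH ic].
  by rewrite subn0; split=> //= -[j [u [/andP[cj jc]]]]; rewrite ltnNge jc in cj.
rewrite [iteri _ _ _]/= sat_And (sat_Imp v (Not _)) sat_Not (sat_Imp v (hasF _ _)).
rewrite sat_hasF sat_valF -/S.
rewrite IH; last exact: ltnW.
rewrite subSS subSn//; set k := c - i; have kc : k <= c by exact: leq_subr.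
split.
  have [hk [/(_ hk)[w [kw ->]] _]|nk [_ /(_ nk)]] := EM (exists w, codes k w S).
    by exists k, w; split=> //; rewrite ?leqnn//; lia.
  move=> [j [u [jk ju j_min vE]]]; exists j, u; split=> //; first lia.
  move=> j'; have [->|jk' h] := eqVneq j' k; last by apply: j_min; lia.
  by move=> _ w kw; apply: nk; exists w.
move=> [j [u [jk ju j_min vE]]].
have [jE|jk'] := eqVneq j k.
  by rewrite jE in ju vE; split=> [_|[]]; exists u.
have nk : ~ exists w, codes k w S by move=> [w]; apply: j_min; lia.
split=> // _; exists j, u; split=> //; first lia.
by move=> j' h; apply: j_min; lia.
Qed.

(** * Computability and uniform definability of the extension *)

Section Computability.
Variables (X : Type) (rep : X -> seq nat) (n : nat).
Local Notation cn := (cnat B rep n).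
Local Notation cf := (cfm B rep n).

Lemma cfm_kernel_spec F G : cf F -> cf G -> cf (fun x => kernel_spec (F x) (G x)).
Proof. by move=> cF cG; rewrite /kernel_spec; repeat cfm_step. Qed.

End Computability.

Lemma kerF_computable : cfamily B kerF.
Proof.
suff cg : cmp B 1 (fun s : seq nat => ex_minn (kernel_spec_ex (nth 0 s 0))).
  apply: (@cmp_cfm _ _ 1 (fun s : seq nat => kerF (nth 0 s 0))).
  by apply: cfm_dec; [exact: cnat_const|exact: cnat_id].
pose f m (s : seq nat) : nat := ~~ B (gn (kernel_spec (dec L 2 (nth 0 s 0)) (dec L 2 m))).
apply: (@cmp_mu _ _ f) => [|s _]; last first.
  rewrite /f; case: ex_minnP => d Bd d_min; split=> [|m]; first by rewrite Bd.
  by rewrite ltnNge; apply: contra; case: (boolP (B _)) => // /d_min.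
apply: cmpb_neg; apply: cmp_oracle.
apply: (@cmp_cfm _ _ 2 (fun t : seq nat =>
  kernel_spec (dec L 2 (nth 0 (drop 1 t) 0)) (dec L 2 (nth 0 t 0)))).
apply: cfm_kernel_spec; apply: cfm_dec; try exact: cnat_const; apply: cnat_id.
  exact: (@cmp_nth_drop _ 1 0 1).
exact: cmp_nth.
Qed.

Lemma tagF_computable : cfamily B tagF.
Proof.
apply: cfamilyP.
apply: (@cfm_iteri _ _ _ _ _ _ _ (fun _ p _ => tagS p)).
- by apply: cnat_id1.
- exact: cfm_const.
- by rewrite /tagS; repeat cfm_step; exact: cfm_step_formula.
Qed.

Lemma extF_computable : cfamily B extF.
Proof.
apply: cfamilyP.
apply: (@cfm_iteri _ _ _ _ _ _ _ (fun i p c => ext_step c i p)).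
- by apply/cnat_succ/cnat_id1.
- exact: cfm_const.
have cc : cnat B (@step_rep L _ (fun c => [:: c])) 3 (fun z => z.2).
  by apply: (@cnat_step _ _ _ _ 1 id); exact: cnat_id1.
have cj := cnat_sub cc (@cnat_step_index B L _ (fun c => [:: c]) 1).
rewrite /ext_step /hasF /valF /same; repeat cfm_step => //.
- exact: cfm_family kerF_computable cj.
- exact: cfm_family tagF_computable cj.
- exact: cfm_step_formula.
Qed.

(** The formula number [c] is turned into one with a single parameter by [k - 1] merges. The number
    of the result is a known code of the fiber, so [extF] applies to it, and the parameter is then
    unpacked again. *)
Definition unif k c : formula L :=
  expand (k - 1) (extF (gn (compress 1 (k - 1) (dec L k.+1 c)))).

Lemma unif_computable : cmp B 2 (fun s : seq nat => gn (unif (nth 0 s 0) (nth 0 s 1))).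
Proof.
apply: (@cmp_cfm _ _ 2 (fun s : seq nat => unif (nth 0 s 0) (nth 0 s 1))).
have c0 : cnat B id 2 (nth 0 ^~ 0) by apply/cnat_id/cmp_nth.
have c1 : cnat B id 2 (nth 0 ^~ 1) by apply/cnat_id/cmp_nth.
have ck := cnat_sub c0 (@cnat_const B _ id 2 1).
apply: cfm_expand => //; apply: cfm_family extF_computable _.
apply: cfm_compress => //; first exact: cnat_const.
by apply: cfm_dec => //; exact: cnat_succ.
Qed.

Lemma ext_ex (S : D M 1) : exists b, is_ext (fun x => sval S [tuple x]) b.
Proof.
case: S => S Sdef /=; have [p p2 [u pu]] := definable_one_parameter Sdef.
by apply: (@is_ext_ex (gn p) u) => x; rewrite gnK.
Qed.

Definition extension (S : D M 1) : M := projT1 (cid (ext_ex S)).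

Lemma extensionP S : is_ext (fun x => sval S [tuple x]) (extension S).
Proof. by rewrite /extension; case: cid. Qed.

Lemma D_eq n (R S : D M n) : R = S <-> forall x, sval R x <-> sval S x.
Proof.
split=> [->//|]; case: R S => [R Rd] [S Sd] /= RS.
by apply: eq_exist; apply/predeqP.
Qed.

Lemma extension_inj R S : extension R = extension S <-> R = S.
Proof.
split=> [e|->//]; apply/D_eq => x.
have eR := extensionP R; rewrite e in eR.
have := is_ext_inj eR (extensionP S) (thead x).
suff <- : x = [tuple thead x] by [].
by apply: eq_from_tnth => i; rewrite (ord1 i).
Qed.

Lemma extension_unif k th (th_k : fv_lt (1 + k) th) : 0 < k ->
  fv_lt (1 + k) (unif k (gn th)) /\ forall (a : k.-tuple M) b,
    extension (fiber a th_k) = b <-> holds (unif k (gn th)) (b :: a).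
Proof.
case: k th_k => // k th_k _; rewrite /unif gnK// subn1 /=.
have [c2 cP] := @compressP 1 k th th_k.
have [e2 eP] := expandP k (extF_fv (gn (compress 1 k th))).
split=> // a b; rewrite eP ?size_tuple//.
have Sb : holds (extF (gn (compress 1 k th))) [:: b; tup a] <->
    is_ext (fun x => sval (fiber a th_k) [tuple x]) b.
  rewrite (holdsE (fun=> z0)) ?extF_fv// sat_extF gnK// /extend /=.
  suff H x : holds (compress 1 k th) [:: x; tup a] <-> holds th (x :: a).
    by split; apply: eq_is_ext => x; rewrite H.
  rewrite (cP [:: x])//; split=> [[t [tk /tup_inj <-]]|h]; rewrite ?size_tuple//.
  by exists a; rewrite size_tuple.
rewrite Sb; split=> [<-|]; first exact: extensionP.
exact: is_ext_uniq (extensionP _).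
Qed.

Lemma extension_uniformly_definable :
  computably_uniformly_definable B extension.
Proof.
exists (fun k th => unif k (gn th)); split=> [k th th_k|].
  exact: extension_unif.
by have [p pP] := unif_computable; exists p => k th _ _; exact: (pP [:: k; gn th]).
Qed.

(** Any code of [S], minimal or not, defines its extension; this is how the terms [BExt X] are
    translated. *)
Lemma extension_codes c u S (b : M) : codes c u (fun x => sval S [tuple x]) ->
  extension S = b <-> holds (extF c) [:: b; u].
Proof.
move=> cu; rewrite (holdsE (fun=> z0)) ?extF_fv// sat_extF /extend /=.
split=> [<-|h]; first by apply: eq_is_ext (extensionP S).
by apply: is_ext_uniq (extensionP S) _; apply: eq_is_ext h => x; rewrite cu.
Qed.

(** * Comprehension *)

Local Notation A := (definable_blstruct extension).

(** * Bounds on variables and arities; blocks of object variables *)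

Definition blterm_lt N (t : blterm) := match t with BVar x => x < N | BExt X => X < N end.

Fixpoint bl_lt N (p : blformula) := match p with
  | BEq t u => blterm_lt N t && blterm_lt N u
  | BREq n X Y => [&& n < N, X < N & Y < N]
  | BApp n X ts => [&& n < N, X < N & all (blterm_lt N) ts]
  | BBot => true
  | BImp p q => bl_lt N p && bl_lt N q
  | BAll x p => (x < N) && bl_lt N p
  | BRAll n X p | BREx n X p => [&& n < N, X < N & bl_lt N p]
  end.

Lemma blterm_lt_leq N N' (t : blterm) : N <= N' -> blterm_lt N t -> blterm_lt N' t.
Proof. by case: t => x /= NN xN; exact: leq_trans xN NN. Qed.

Lemma bl_lt_leq N N' (p : blformula) : N <= N' -> bl_lt N p -> bl_lt N' p.
Proof.
move=> NN; have lt i : i < N -> i < N' by move=> iN; exact: leq_trans iN NN.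
elim: p => /=.
- by move=> t u /andP[? ?]; rewrite !(blterm_lt_leq NN).
- by move=> n X Y /and3P[? ? ?]; rewrite !lt.
- move=> n X ts /and3P[? ? tsN]; rewrite !lt//=.
  by apply: sub_all tsN => t; exact: blterm_lt_leq.
- by [].
- by move=> p IHp q IHq /andP[/IHp -> /IHq ->].
- by move=> x p IH /andP[? /IH ->]; rewrite lt.
- by move=> n X p IH /and3P[? ? /IH ->]; rewrite !lt.
- by move=> n X p IH /and3P[? ? /IH ->]; rewrite !lt.
Qed.

Lemma bl_lt_ex (p : blformula) : exists N, bl_lt N p.
Proof.
have term_ex (t : blterm) : exists N, blterm_lt N t by case: t => x; exists x.+1 => /=.
have ge i a b : (i < a -> i < maxn a b) /\ (i < b -> i < maxn a b).
  by rewrite leq_max; split=> ->; rewrite ?orbT.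
elim: p => /=.
- move=> t u; have [N tN] := term_ex t; have [N' uN] := term_ex u.
  exists (maxn N N'); rewrite (blterm_lt_leq _ tN) ?(blterm_lt_leq _ uN)//.
    exact: leq_maxr.
  exact: leq_maxl.
- by move=> n X Y; exists (n + X + Y).+1; lia.
- move=> n X [ts _] /=.
  have [N tsN] : exists N, all (blterm_lt N) ts.
    elim: ts => [|t ts [N tsN]]; first by exists 0.
    have [N' tN] := term_ex t; exists (maxn N N').
    rewrite /= (blterm_lt_leq _ tN) ?leq_maxr//=.
    by apply: sub_all tsN => u; apply: blterm_lt_leq; exact: leq_maxl.
  exists (N + n + X).+1; apply/and3P; split; try lia.
  by apply: sub_all tsN => u; apply: blterm_lt_leq; lia.
- by exists 0.
- move=> p [N pN] q [N' qN]; exists (maxn N N').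
  by rewrite (bl_lt_leq _ pN) ?(bl_lt_leq _ qN)// ?leq_maxr ?leq_maxl.
- move=> x p [N pN]; exists (maxn x.+1 N).
  by rewrite (bl_lt_leq _ pN) ?leq_maxr// leq_max ltnSn.
- move=> n X p [N pN]; exists (maxn (n + X).+1 N).
  by rewrite (bl_lt_leq _ pN) ?leq_maxr// !leq_max !ltnS leq_addr leq_addl.
- move=> n X p [N pN]; exists (maxn (n + X).+1 N).
  by rewrite (bl_lt_leq _ pN) ?leq_maxr// !leq_max !ltnS leq_addr leq_addl.
Qed.

Definition assign z s v : nat -> M :=
  fun j => if z <= j < z + size s then nth (v j) s (j - z) else v j.

Lemma assign_cons z a s v : assign z.+1 s [eta v with z |-> a] = assign z (a :: s) v.
Proof.
apply/funext => j; rewrite /assign /= addnS addSn.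
case: (ltngtP z j) => [zj|zj|<-]; rewrite ?eqxx ?subnn ?leq_addr//=.
by rewrite -(subnSK zj).
Qed.

Lemma assign_out z s v j : j < z -> assign z s v j = v j.
Proof. by move=> jz; rewrite /assign leqNgt jz. Qed.

Lemma map_assign z s v : [seq assign z s v i | i <- iota z (size s)] = s.
Proof.
apply: (@eq_from_nth _ z0); rewrite size_map size_iota// => i im.
rewrite (nth_map 0) ?size_iota// nth_iota// /assign leq_addr ltn_add2l im addKn.
exact: set_nth_default.
Qed.

Fixpoint exblock z m p : formula L :=
  if m is m'.+1 then Ex z (exblock z.+1 m' p) else p.

Lemma sat_exblock v z m p :
  sat v (exblock z m p) <-> exists2 s, size s = m & sat (assign z s v) p.
Proof.
elim: m z v => [|m IH] z v.
  have v0 : assign z [::] v = v.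
    by apply/funext => j; rewrite /assign addn0; case: ifP => //; lia.
  by split=> [h|[s /size0nil ->]]; rewrite ?v0//; exists [::]; rewrite ?v0.
rewrite [exblock _ _ _]/= sat_Ex; split=> [[a /IH[s sm]]|[[//|a s] [sm]]].
  by rewrite assign_cons; exists (a :: s); rewrite /= ?sm.
by rewrite -assign_cons => h; exists a; apply/IH; exists s.
Qed.

Lemma fvin_exblock (Q : pred nat) z m p :
  fvin (fun i => Q i || (z <= i < z + m)) p -> fvin Q (exblock z m p).
Proof.
elim: m z Q => [|m IH] z Q /= pQ.
  by apply: sub_fvin pQ => i; case: (Q i) => //; lia.
rewrite fvin_Ex; apply: IH; apply: sub_fvin pQ => i.
by case: (Q i); rewrite ?implybT//=; lia.
Qed.

(** * Translation into the language of [M], for formula numbers [e] assigned to the relation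
    variables *)

Section Translation.
Variable N : nat.

(* Object variables [x < N] are kept; the parameter of the relation variable
   [(n, X)], with [n, X < N], is [pvar n X]; variables from [top] on are
   auxiliary. *)
Definition pvar n X := N + (n * N + X).
Definition top := N + N * N.

Lemma pvar_lt n X : n < N -> X < N -> pvar n X < top.
Proof. by rewrite /pvar /top; nia. Qed.

Lemma pvar_inj n X n' X' : X < N -> X' < N ->
  pvar n X = pvar n' X' -> n = n' /\ X = X'.
Proof.
move=> XN XN' /addnI e.
have N0 : 0 < N by exact: leq_ltn_trans XN.
have := congr1 (divn^~ N) e; have := congr1 (modn^~ N) e.
by rewrite !modnMDl !modn_small// !divnMDl// !divn_small// !addn0 => -> ->.
Qed.

Implicit Types (e : nat -> nat -> nat).

(** The arguments are read from the auxiliary variables [top, ..., top + n], where [bindF] and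
    [exblock] put them. *)
Definition relF e n X : formula L :=
  subst (dec L n.+2 (e n X)) (rcons (iota top n.+1) (pvar n X)).

Definition eqrelF e n X Y : formula L :=
  Not (exblock top n.+1 (Not (Iff (relF e n X) (relF e n Y)))).

(** Terms are translated by their graphs, with the value in [z], since an extension is definable in
    [M] but not given by a term of [L]. *)
Definition termF e (t : blterm) z : formula L :=
  match t with
  | BVar x => Eq (Var x) (Var z)
  | BExt X => subst (extF (e 0 X)) [:: z; pvar 0 X]
  end.

Fixpoint bindF e (ts : seq blterm) z p : formula L :=
  if ts is t :: ts' then Ex z (And (termF e t z) (bindF e ts' z.+1 p)) else p.

Fixpoint trans e (p : blformula) : formula L :=
  match p with
  | BEq t u => Ex top (And (termF e t top) (termF e u top))
  | BREq n X Y => eqrelF e n X Y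
  | BApp n X ts => bindF e ts top (relF e n X)
  | BImp p q => Imp (trans e p) (trans e q)
  | BAll x p => All x (trans e p)
  | BBot | BRAll _ _ _ | BREx _ _ _ => Bot
  end.

Definition agree (v w : nat -> M) := forall x, x < N -> v x = w x.

Definition represents e (w : nat -> M) (r : forall n, nat -> relsort A n) :=
  forall n X, n < N -> X < N -> forall x : n.+1.-tuple M,
    sval (r n X) x <-> holds (dec L n.+2 (e n X)) (rcons x (w (pvar n X))).

Definition below_top_eq (w w' : nat -> M) := forall j, j < top -> w j = w' j.

Lemma agree_below v w w' : below_top_eq w w' -> agree v w -> agree v w'.
Proof. by move=> ww vw x xN; rewrite vw// ww// /top ltn_addr. Qed.

Lemma represents_below e r w w' :
  below_top_eq w w' -> represents e w r -> represents e w' r.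
Proof.
by move=> ww wr n X nN XN x; rewrite wr// ww//; exact: pvar_lt.
Qed.

Lemma below_upd w z a : top <= z -> below_top_eq w [eta w with z |-> a].
Proof. by move=> tz j jt /=; case: eqP => // jz; move: jt; rewrite jz ltnNge tz. Qed.

Lemma sat_relF e w r n X (x : n.+1.-tuple M) : n < N -> X < N ->
  represents e w r ->
  sat (assign top x w) (relF e n X) <-> sval (r n X) x.
Proof.
move=> nN XN wr; rewrite sat_subst ?size_rcons ?size_iota ?dec_fv//.
rewrite map_rcons -[X in iota _ X](size_tuple x) map_assign assign_out ?pvar_lt//.
by rewrite wr.
Qed.

Lemma sat_termF e v w r (t : blterm) z : blterm_lt N t -> agree v w -> represents e w r ->
  sat w (termF e t z) <-> bleval (A := A) v r t = w z.
Proof.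
case: t => [x|X] /= tN vw wr; first by rewrite vw.
rewrite sat_subst ?extF_fv//=; apply: iff_sym.
apply: extension_codes => x; have N0 : 0 < N by exact: leq_ltn_trans tN.
exact: (wr 0 X N0 tN [tuple x]).
Qed.

Lemma sat_bindF e v w r (ts : seq blterm) z p : all (blterm_lt N) ts -> top <= z ->
  agree v w -> represents e w r ->
  sat w (bindF e ts z p) <-> sat (assign z (map (bleval (A := A) v r) ts) w) p.
Proof.
elim: ts z w => [|t ts IH] z w.
  move=> *; suff -> : assign z [::] w = w by [].
  by apply/funext => j; rewrite /assign addn0; case: ifP => //; lia.
move=> /andP[tN tsN] zt vw wr; rewrite [bindF _ _ _ _]/= sat_Ex.
have H a : sat [eta w with z |-> a] (And (termF e t z) (bindF e ts z.+1 p)) <->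
    bleval (A := A) v r t = a /\ sat (assign z (a :: (map (bleval (A := A) v r) ts)) w) p.
  have ww := below_upd w a zt.
  have vw' := agree_below ww vw; have wr' := represents_below ww wr.
  rewrite sat_And (sat_termF _ tN vw' wr') /= eqxx IH//; last exact: ltnW.
  by rewrite assign_cons.
by split=> [[a /H[<-]]//|h]; exists (bleval (A := A) v r t); apply/H.
Qed.

Lemma sat_trans e v w r (p : blformula) : arithmetical p -> bl_lt N p ->
  agree v w -> represents e w r -> sat w (trans e p) <-> blsat (A := A) v r p.
Proof.
elim: p v w => //.
- move=> t u v w _ /andP[tN uN] vw wr; rewrite [trans _ _]/= [blsat _ _ _]/= sat_Ex.
  have H a : sat [eta w with top |-> a] (And (termF e t top) (termF e u top)) <->
      bleval (A := A) v r t = a /\ bleval (A := A) v r u = a.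
    have ww := below_upd w a (leqnn top).
    have vw' := agree_below ww vw; have wr' := represents_below ww wr.
    by rewrite sat_And (sat_termF _ tN vw' wr') (sat_termF _ uN vw' wr') /= eqxx.
  by split=> [[a /H[-> ->]]//|tu]; exists (bleval (A := A) v r t); apply/H.
- move=> n X Y v w _ /and3P[nN XN YN] vw wr; rewrite [trans _ _]/= [blsat _ _ _]/= /eqrelF.
  rewrite sat_Not sat_exblock.
  rewrite D_eq; split=> [h x|h [s sn]].
    apply: contrapT => XY; apply: h; exists x; rewrite ?size_tuple//.
    by rewrite sat_Not sat_Iff !(sat_relF _ _ _ wr).
  rewrite sat_Not sat_Iff; move/eqP: sn => sn.
  by rewrite !(@sat_relF _ _ _ _ _ (Tuple sn) _ _ wr).
- move=> n X ts v w _ /and3P[nN XN tsN] vw wr.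
  rewrite [trans _ _]/= (sat_bindF _ tsN (leqnn _) vw wr).
  exact: (@sat_relF _ _ _ _ _ (map_tuple (bleval (A := A) v r) ts)).
- move=> p IHp q IHq v w /andP[pa qa] /andP[pN qN] vw wr.
  by have := IHp v w pa pN vw wr; have := IHq v w qa qN vw wr; rewrite /=; tauto.
- move=> x p IH v w pa /andP[xN pN] vw wr.
  have H a : sat [eta w with x |-> a] (trans e p) <->
      blsat (A := A) [eta v with x |-> a] r p.
    apply: IH => // [y yN|n X nN XN y] /=; first by case: eqP => // _; exact: vw.
    (* Object variables lie below [N] and the parameters of relation variables from [N] on, so the
       update does not disturb the latter. *)
    rewrite wr// ifF//; apply/eqP; rewrite /pvar; lia.
  by split=> h a; apply/H; exact: h.
Qed.

Lemma fvin_termF (Q : pred nat) e (t : blterm) z :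
  (forall i, i < top -> Q i) -> Q z -> blterm_lt N t -> fvin Q (termF e t z).
Proof.
move=> Qtop Qz; case: t => [x|X] /= tN.
  by rewrite fvin_Eqv Qz Qtop// /top ltn_addr.
apply: fvin_subst; first exact: extF_fv.
by rewrite /= Qz Qtop// pvar_lt//; exact: leq_ltn_trans tN.
Qed.

Lemma fvin_relF (Q : pred nat) e n X : n < N -> X < N ->
  (forall i, i < top + n.+1 -> Q i) -> fvin Q (relF e n X).
Proof.
move=> nN XN Qtop; apply: fvin_subst; rewrite ?size_rcons ?size_iota ?dec_fv//.
rewrite all_rcons Qtop ?andTb; last by rewrite ltn_addr ?pvar_lt.
by apply/allP => i; rewrite mem_iota => /andP[_ it]; exact: Qtop.
Qed.

Lemma fvin_bindF (Q : pred nat) e (ts : seq blterm) z p :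
  (forall i, i < top -> Q i) -> all (blterm_lt N) ts ->
  fvin (fun i => Q i || (z <= i < z + size ts)) p -> fvin Q (bindF e ts z p).
Proof.
elim: ts z Q => [|t ts IH] z Q Qtop tsN.
  by apply: sub_fvin => i; case: (Q i) => //=; lia.
case/andP: tsN => tN tsN pQ; rewrite [bindF _ _ _ _]/= fvin_Ex fvin_And.
apply/andP; split.
  apply: fvin_termF => // [i /Qtop ->|]; rewrite ?implybT// eqxx//.
apply: IH => // [i /Qtop ->|]; first by rewrite implybT.
by apply: sub_fvin pQ => i /=; case: (Q i); rewrite ?implybT//=; lia.
Qed.

Lemma fv_trans e (p : blformula) : bl_lt N p -> fv_lt top (trans e p).
Proof.
have wk q (Q : pred nat) : fv_lt top q -> (forall i, i < top -> Q i) -> fvin Q q.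
  by move=> qt Qt; exact: sub_fvin Qt qt.
elim: p => //.
- move=> t u /andP[tN uN]; rewrite [trans _ _]/= fv_ltE fvin_Ex fvin_And.
  apply/andP; split; apply: fvin_termF => //= [i ->|]; rewrite ?implybT ?eqxx//.
- move=> n X Y /and3P[nN XN YN]; rewrite [trans _ _]/= /eqrelF fv_ltE fvin_Not.
  apply: fvin_exblock; rewrite fvin_Not fvin_Iff.
  by apply/andP; split; apply: fvin_relF => // i it; lia.
- move=> n X ts /and3P[nN XN tsN]; rewrite [trans _ _]/= fv_ltE.
  apply: fvin_bindF => //; rewrite size_tuple.
  by apply: fvin_relF => // i it; lia.
- by move=> p IHp q IHq /andP[/IHp pt /IHq qt]; rewrite fv_ltE fvin_Imp; apply/andP.
- move=> x p IH /andP[xN /IH pt]; rewrite [trans _ _]/= fv_ltE fvin_All.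
  by apply: wk pt _ => i ->; rewrite implybT.
Qed.

Definition upd_code e n X c : nat -> nat -> nat :=
  fun n' X' => if (n' == n) && (X' == X) then c else e n' X'.

(* The relation quantifiers of the prefix range over formulas with one
   parameter; their numbers are coded by [i]. *)
Fixpoint trans_sigma e (p : blformula) i : formula L :=
  match p with
  | BREx n X q => Ex (pvar n X) (trans_sigma (upd_code e n X (upr1 i)) q (upr2 i))
  | _ => trans e p
  end.

Fixpoint trans_pi e (p : blformula) i : formula L :=
  match p with
  | BRAll n X q => All (pvar n X) (trans_pi (upd_code e n X (upr1 i)) q (upr2 i))
  | _ => trans e p
  end.

Lemma fv_trans_sigma e (p : blformula) i :
  bl_lt N p -> fv_lt top (trans_sigma e p i).
Proof.
elim: p e i; try by move=> *; exact: fv_trans.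
move=> n X p IH e i /and3P[_ _ /(IH (upd_code e n X (upr1 i)) (upr2 i)) pt].
by rewrite fv_ltE [trans_sigma _ _ _]/= fvin_Ex; apply: sub_fvin pt => j ->; rewrite implybT.
Qed.

Lemma fv_trans_pi e (p : blformula) i : bl_lt N p -> fv_lt top (trans_pi e p i).
Proof.
elim: p e i; try by move=> *; exact: fv_trans.
move=> n X p IH e i /and3P[_ _ /(IH (upd_code e n X (upr1 i)) (upr2 i)) pt].
by rewrite fv_ltE [trans_pi _ _ _]/= fvin_All; apply: sub_fvin pt => j ->; rewrite implybT.
Qed.

Lemma set_rel_in r n X (R : relsort A n) : set_rel r X R n X = R.
Proof. by rewrite /set_rel dfwith_in /= eqxx. Qed.

Lemma set_rel_out (r : forall n, nat -> relsort A n) n X (R : relsort A n) n' X' :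
  (n' == n) && (X' == X) = false -> set_rel r X R n' X' = r n' X'.
Proof.
rewrite /set_rel; have [-> /= h|nn _] := eqVneq n' n.
  by rewrite dfwith_in /= h.
by rewrite dfwith_out// eq_sym.
Qed.

Lemma represents_set_rel e w r n X (R : relsort A n) c u : n < N -> X < N ->
  represents e w r ->
  (forall x : n.+1.-tuple M, sval R x <-> holds (dec L n.+2 c) (rcons x u)) ->
  represents (upd_code e n X c) [eta w with pvar n X |-> u] (set_rel r X R).
Proof.
move=> nN XN wr Rc n' X' nN' XN'; rewrite /upd_code /=.
case: ifP => [/andP[/eqP -> /eqP ->] x|nX x].
  by rewrite set_rel_in eqxx.
rewrite set_rel_out// wr// ifF//; apply/eqP => /(pvar_inj XN' XN)[nE XE].
by rewrite nE XE !eqxx in nX.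
Qed.

Lemma agree_pvar v w n X a : agree v w -> agree v [eta w with pvar n X |-> a].
Proof.
by move=> vw x xN /=; rewrite vw//; case: eqP => // xE; move: xN; rewrite xE /pvar; lia.
Qed.

Lemma D_code n (R : D M n.+1) : exists c u, forall x : n.+1.-tuple M,
  sval R x <-> holds (dec L n.+2 c) (rcons x u).
Proof.
case: R => R Rdef /=; have [p pn [u pu]] := definable_one_parameter Rdef.
by exists (gn p), u => x; rewrite gnK.
Qed.

Lemma code_D n c u : exists R : D M n.+1, forall x : n.+1.-tuple M,
  sval R x <-> holds (dec L n.+2 c) (rcons x u).
Proof.
have Rdef : definable [set x : n.+1.-tuple M | holds (dec L n.+2 c) (rcons x u)].
  exists 1, [tuple u], (dec L n.+2 c); split=> [|x]; first by rewrite addn1 dec_fv.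
  by rewrite /= cats1.
by exists (exist _ _ Rdef).
Qed.

(** By [D_code] and [code_D], a quantifier over definable relations splits into one over formula
    numbers, packed into [i], and one over parameters, which is an object quantifier of [L]. *)
Lemma sat_trans_sigma e v w r (p : blformula) : sigma11 p -> bl_lt N p ->
  agree v w -> represents e w r ->
  blsat (A := A) v r p <-> exists i, sat w (trans_sigma e p i).
Proof.
have base (q : blformula) e' w' r' : arithmetical q -> bl_lt N q -> agree v w' ->
    represents e' w' r' -> blsat (A := A) v r' q <-> exists i : nat, sat w' (trans e' q).
  move=> qa qN vw wr; rewrite -(sat_trans qa qN vw wr).
  by split=> [h|[]//]; exists 0.
elim: p e w r; try by move=> *; exact: base.
move=> n X p IH e w r ps /and3P[nN XN pN] vw wr; split=> [[R Rp]|[i]].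
  have [c [u Rc]] := D_code R.
  have wr' := represents_set_rel nN XN wr Rc.
  have [i ip] := (IH _ _ _ ps pN (agree_pvar n X u vw) wr').1 Rp.
  have [k [k1 k2]] := upr_surj c i.
  by exists k; apply/sat_Ex; exists u; rewrite k1 k2.
rewrite [trans_sigma _ _ _]/= => /sat_Ex[u ip].
have [R Rc] := code_D n (upr1 i) u.
exists R; apply/(IH _ _ _ ps pN (agree_pvar n X u vw) (represents_set_rel nN XN wr Rc)).
by exists (upr2 i).
Qed.

Lemma sat_trans_pi e v w r (p : blformula) : pi11 p -> bl_lt N p ->
  agree v w -> represents e w r ->
  blsat (A := A) v r p <-> forall i, sat w (trans_pi e p i).
Proof.
have base (q : blformula) e' w' r' : arithmetical q -> bl_lt N q -> agree v w' ->
    represents e' w' r' -> blsat (A := A) v r' q <-> forall i : nat, sat w' (trans e' q).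
  by move=> qa qN vw wr; rewrite -(sat_trans qa qN vw wr); split=> // /(_ 0).
elim: p e w r; try by move=> *; exact: base.
move=> n X p IH e w r ps /and3P[nN XN pN] vw wr; split=> [Rp i|h R].
  rewrite [trans_pi _ _ _]/= sat_All => u.
  have [R Rc] := code_D n (upr1 i) u.
  apply: (IH _ _ _ ps pN (agree_pvar n X u vw) (represents_set_rel nN XN wr Rc)).1.
  exact: Rp.
have [c [u Rc]] := D_code R.
apply/(IH _ _ _ ps pN (agree_pvar n X u vw) (represents_set_rel nN XN wr Rc)) => i.
have [k [k1 k2]] := upr_surj c i.
by have /(sat_inst u) := h k; rewrite -/trans_pi k1 k2.
Qed.

(** * Computability of the translation *)

Section Computability.
Variables (X : Type) (rep : X -> seq nat) (m : nat).
Local Notation cn := (cnat B rep m).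
Local Notation cf := (cfm B rep m).
Implicit Types E : X -> nat -> nat -> nat.

Lemma cfm_relF E n k : cn (fun x => E x n k) -> cf (fun x => relF (E x) n k).
Proof.
move=> cE; apply: cfm_subst_const; apply: cfm_dec => //; exact: cnat_const.
Qed.

Lemma cfm_termF E (t : blterm) z : (forall n k, cn (fun x => E x n k)) ->
  cf (fun x => termF (E x) t z).
Proof.
move=> cE; case: t => [y|Y]; first exact: cfm_const.
apply: cfm_subst_const; apply: cfm_family extF_computable _; exact: cE.
Qed.

Lemma cfm_bindF E (ts : seq blterm) z F : (forall n k, cn (fun x => E x n k)) ->
  cf F -> cf (fun x => bindF (E x) ts z (F x)).
Proof.
move=> cE cF; elim: ts z => [//|t ts IH] z.
apply: cfm_Ex; first exact: cnat_const.
by apply: cfm_And; [exact: cfm_termF|exact: IH].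
Qed.

Lemma cfm_exblock z k F : cf F -> cf (fun x => exblock z k (F x)).
Proof.
move=> cF; elim: k z => [//|k IH] z.
by apply: cfm_Ex; [exact: cnat_const|exact: IH].
Qed.

(** Here [p] is fixed, so the induction on it is external; only the formula numbers vary, and they
    enter through [dec] and [extF]. *)
Lemma cfm_trans E (p : blformula) : (forall n k, cn (fun x => E x n k)) ->
  cf (fun x => trans (E x) p).
Proof.
move=> cE; elim: p => [t u|n Y Z|n Y ts||p IHp q IHq|y p IH|n Y p _|n Y p _].
- apply: cfm_Ex; first exact: cnat_const.
  by apply: cfm_And; exact: cfm_termF.
- by apply/cfm_Not/cfm_exblock/cfm_Not/cfm_Iff; exact: cfm_relF.
- by apply: cfm_bindF => //; exact: cfm_relF.
- exact: cfm_const.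
- exact: cfm_Imp.
- by apply: cfm_All => //; exact: cnat_const.
- exact: cfm_const.
- exact: cfm_const.
Qed.

Lemma cnat_upd_code E n Y c : (forall n k, cn (fun x => E x n k)) -> cn c ->
  forall n' k, cn (fun x => upd_code (E x) n Y (c x) n' k).
Proof. by move=> cE cc n' k; rewrite /upd_code; case: (_ && _). Qed.

Lemma cnat_upr1 f : cn f -> cn (fun x => upr1 (f x)).
Proof. by apply: cnat_unary; apply: cmp_upr1; exact: cmp_nth. Qed.

Lemma cnat_upr2 f : cn f -> cn (fun x => upr2 (f x)).
Proof. by apply: cnat_unary; apply: cmp_upr2; exact: cmp_nth. Qed.

Lemma cfm_trans_sigma E (p : blformula) i : (forall n k, cn (fun x => E x n k)) ->
  cn i -> cf (fun x => trans_sigma (E x) p (i x)).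
Proof.
elim: p E i; try by move=> *; exact: cfm_trans.
move=> n Y p IH E i cE ci; apply: cfm_Ex; first exact: cnat_const.
apply: (IH (fun x => upd_code (E x) n Y (upr1 (i x)))); last exact: cnat_upr2.
by apply: cnat_upd_code => //; exact: cnat_upr1.
Qed.

Lemma cfm_trans_pi E (p : blformula) i : (forall n k, cn (fun x => E x n k)) ->
  cn i -> cf (fun x => trans_pi (E x) p (i x)).
Proof.
elim: p E i; try by move=> *; exact: cfm_trans.
move=> n Y p IH E i cE ci; apply: cfm_All; first exact: cnat_const.
apply: (IH (fun x => upd_code (E x) n Y (upr1 (i x)))); last exact: cnat_upr2.
by apply: cnat_upd_code => //; exact: cnat_upr1.
Qed.

End Computability.

End Translation.

(** * Comprehension from saturation *)

Lemma extension_comprehension :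
  recursively_saturated B M -> delta11_comprehension A.
Proof.
move=> Msat n phi psi v r phiS psiP phi_psi.
have [N1 phiN1] := bl_lt_ex phi; have [N2 psiN2] := bl_lt_ex psi.
(* [N] also bounds [n.+1], so the comprehended variables precede every [pvar]. *)
pose N := maxn n.+1 (maxn N1 N2).
have phiN : bl_lt N phi by apply: bl_lt_leq phiN1; rewrite !leq_max leqnn !orbT.
have psiN : bl_lt N psi by apply: bl_lt_leq psiN2; rewrite !leq_max leqnn !orbT.
have nN : n.+1 <= N by rewrite leq_maxl.
have NT : N <= top N by exact: leq_addr.
have [cu cuP] : exists f : nat -> nat -> nat * M, forall k X (x : k.+1.-tuple M),
    sval (r k X) x <-> holds (dec L k.+2 (f k X).1) (rcons x (f k X).2).
  have H k X : exists cu : nat * M, forall x : k.+1.-tuple M,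
      sval (r k X) x <-> holds (dec L k.+2 cu.1) (rcons x cu.2).
    by have [c [u cP]] := D_code (r k X); exists (c, u).
  by exists (fun k X => projT1 (cid (H k X))) => k X; case: cid.
pose e k X := (cu k X).1.
(* Division by [N] inverts [pvar]: the variables from [N] on receive the parameters chosen for the
   relations of [r]. *)
pose w j := if j < N then v j else (cu ((j - N) %/ N) ((j - N) %% N)).2.
have ag (x : n.+1.-tuple M) : agree N (extend x v) (extend x w).
  by move=> j jN; rewrite /extend /w jN.
have rep (x : n.+1.-tuple M) : represents N e (extend x w) r.
  move=> k X kN XN y; rewrite cuP /e /extend nth_default; last first.
    by rewrite size_tuple (leq_trans nN)// /pvar leq_addr.
  have N0 : 0 < N by exact: leq_ltn_trans XN.
  rewrite /w /pvar ltnNge leq_addr /= addKn.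
  by rewrite divnMDl// divn_small// addn0 modnMDl modn_small.
have phiE (x : n.+1.-tuple M) := sat_trans_sigma phiS phiN (ag x) (rep x).
have psiE (x : n.+1.-tuple M) := sat_trans_pi psiP psiN (ag x) (rep x).
(* The type is in the variables [0, ..., n]; the values of [w] at the remaining variables below
   [top N] are its finitely many parameters. *)
pose k := top N - n.+1; pose a : k.-tuple M := [tuple w (n.+1 + i) | i < k].
have nk : n.+1 + k = top N by rewrite subnKC// (leq_trans nN).
have holds_a (x : n.+1.-tuple M) p :
    fv_lt (top N) p -> holds p (x ++ a) <-> sat (extend x w) p.
  move=> pT; apply: holds_sat => [|i].
    by rewrite size_cat !size_tuple nk.
  rewrite size_cat !size_tuple nk => iT; rewrite nth_cat size_tuple /extend.
  case: ltnP => ni; first by apply: set_nth_default; rewrite size_tuple.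
  have ik : i - n.+1 < k by rewrite ltn_sub2r// (leq_ltn_trans ni).
  rewrite nth_default ?size_tuple//.
  rewrite -[i - n.+1]/(nat_of_ord (Ordinal ik)) -tnth_nth tnth_mktuple /=.
  by rewrite subnKC.
(* The premise records [i], which makes the set of the formulas [G_ i] decidable. *)
pose G_ i := Imp (All i (Imp Bot Bot))
  (And (Not (trans_sigma N e phi i)) (trans_pi N e psi i)).
have G_fv i : fv_lt (top N) (G_ i).
  rewrite fv_ltE /G_ fvin_Imp fvin_And fvin_Not; apply/and3P; split=> //.
    exact: fv_trans_sigma.
  exact: fv_trans_pi.
have G_comp : computable_set B
    (fun c => `[< exists2 p, [set G_ i | i in [set: nat]] p & gn p = c >]).
  apply: cmp_computable_set.
  apply: (@eq_cmp _ _ (fun s : seq nat => has (fun i => gn (G_ i) == nth 0 s 0)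
    (iota 0 (nth 0 s 0).+1) : nat)) => [s _|].
    congr nat_of_bool; apply/hasP/asboolP => [[i _ /eqP <-]|[_ [i _ <-] <-]].
      by exists (G_ i) => //; exists i.
    by exists i; rewrite // mem_iota add0n ltnS leq_gn_Imp_All.
  apply: (@cmpb_has_iota _ _ (fun i (s : seq nat) => gn (G_ i) == nth 0 s 0)).
    by apply: cmp_succ; exact: cmp_nth.
  apply: cmpb_eq; last exact: (@cmp_nth_drop _ 1 0 2).
  apply: (@cmp_cfm _ _ 3 (fun t : seq nat => G_ (nth 0 t 0))).
  have c0 : cnat B id 3 (nth 0 ^~ 0) by apply/cnat_id/cmp_nth.
  have ce j X : cnat B id 3 (fun=> e j X) by exact: cnat_const.
  rewrite /G_; apply: cfm_Imp; first exact/cfm_All/cfm_const.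
  apply: cfm_And; first by apply: cfm_Not; exact: cfm_trans_sigma.
  exact: cfm_trans_pi.
have sat_G (x : n.+1.-tuple M) i : sat (extend x w) (G_ i) <->
    ~ sat (extend x w) (trans_sigma N e phi i) /\ sat (extend x w) (trans_pi N e psi i).
  by rewrite sat_Imp sat_And sat_Not; split=> [h|//]; apply: h => b.
have [m m_cover] : exists m, forall x : n.+1.-tuple M,
    exists2 i, i < m & ~ sat (extend x w) (G_ i).
  (* Otherwise each initial segment of the type is realized, hence by saturation the whole type.
     There all conjuncts of [psi] hold, so [psi] and thus [phi] hold, although every disjunct of
     [phi] fails. *)
  apply: contrapT => no_m.
  have [p [i _ <-]||x xG] := Msat n.+1 k a _ _ G_comp; first by rewrite nk.
    move=> G0 G0_fin G0G.
    (* Choosing an index for each member places a finite part inside an initial segment. *)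
    have [m G0m] : exists m, forall p, G0 p -> exists2 i, i < m & p = G_ i.
      have [h hP] : exists h : formula L -> nat, forall p, G0 p -> G_ (h p) = p.
        have H p : exists i, G0 p -> G_ i = p.
          by have [/G0G[i _ <-]|np] := EM (G0 p); [exists i|exists 0].
        by have [h hP] := choice H; exists h.
      have /finite_seqP[s hs] := finite_image h G0_fin.
      exists (sumn s).+1 => p G0p; exists (h p); last by rewrite hP.
      have hps : h p \in s by have : [set` s] (h p) by rewrite -hs; exists p.
      by rewrite ltnS sumnE (big_rem _ hps) leq_addr.
    apply: contrapT => no_x; apply: no_m; exists m => x.
    apply: contrapT => all_x; apply: no_x; exists x => p /G0m[i im ->].
    by apply/holds_a => //; apply: contrapT => xi; apply: all_x; exists i.
  have xG' i : sat (extend x w) (G_ i) by apply/holds_a => //; apply: xG; exists i.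
  have /phi_psi/phiE[i] : blsat (A := A) (extend x v) r psi.
    by apply/psiE => i; have /sat_G[] := xG' i.
  by have /sat_G[] := xG' i.
pose q := bigor [seq trans_sigma N e phi i | i <- iota 0 m].
have qT : fv_lt (top N) q.
  by apply: fvin_bigor; rewrite all_map; apply/allP => i _; exact: fv_trans_sigma.
have Rdef : definable [set x : n.+1.-tuple M | holds q (x ++ a)].
  by exists k, a, q; rewrite nk.
exists (exist _ _ Rdef) => x /=; rewrite holds_a// phiE sat_bigor.
split=> [[i _ xi]|[i xi]]; first by exists i.
have /phi_psi/psiE xpsi : blsat (A := A) (extend x v) r phi by apply/phiE; exists i.
(* Some [G_ j] with [j < m] fails at [x]. Its conjunct of [psi] holds there, so the disjunct number
   [j] of [phi] must be true. *)
have [j jm nj] := m_cover x; exists j; first by rewrite mem_iota.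
by apply: contrapT => xj; apply/nj/sat_G.
Qed.


End Extension.

End Pairing.

Theorem theorem4p44 (L : signature) (M : structure L)
  (Mcount : countable [set: M])
  (Msat : recursively_saturated (Th M) M)
  (M_EI : uniform_EI M)
  (Mpair : has_pairing0 M)
  (Mdcl : exists a b : M, [/\ a <> b, dcl0 a & dcl0 b]) :
  exists ext : D M 1 -> M,
    computably_uniformly_definable (Th M) ext /\
    Delta11_BL0 (definable_blstruct ext).
Proof.
have [f [f_inj [prF prF_fv prFP']]] := Mpair.
have [z0 [o1 [z0o1 [zF zF_fv zFP'] [oF oF_fv oFP']]]] := Mdcl.
pose pr a b := f (a, b).
have pr_inj a b c d : pr a b = pr c d -> a = c /\ b = d by move=> /f_inj[-> ->].
have prFP (a b c : M) : holds prF [:: a; b; c] <-> c = pr a b.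
  rewrite -(prFP' [tuple a; b; c]); split=> [[[a' b'] _ /(congr1 val)/= [<- <- <-]]//|->].
  by exists (a, b) => //; exact: val_inj.
have zFP (a : M) : holds zF [:: a] <-> a = z0.
  by rewrite -(zFP' [tuple a]); split=> [/(congr1 val)[]|->].
have oFP (a : M) : holds oF [:: a] <-> a = o1.
  by rewrite -(oFP' [tuple a]); split=> [/(congr1 val)[]|->].
exists (extension z0 pr_inj prF_fv prFP o1 M_EI); split.
  exact: (extension_uniformly_definable pr_inj prF_fv prFP zF_fv oF_fv).
split; first by move=> R S; apply: extension_inj.
exact: (extension_comprehension zF_fv oF_fv).
Qed.
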